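(* Let $K$ be a field of characteristic $0$, let $n\ge 1$, and let ${\cal F}_q[{\rm Mat}_n]$ be the quantized coordinate algebra described in the context, with ${\cal L}$ the $K[q]$-lattice spanned by all quantum bitableaux. Let $w=i_1\cdots i_k$ and $u=j_1\cdots j_k$ be two words of the same length $k$ on the alphabet $\{1,\ldots,n\}$, and let $(P(w),Q(w))$ and $(P(u),Q(u))$ be their images under the Robinson–Schensted correspondence. Then $$ t_{i_1j_1}t_{i_2j_2}\cdots t_{i_kj_k}\equiv\begin{cases}(P(w)\,|\,P(u)) \pmod{q{\cal L}} & \text{if } Q(w)=Q(u),\\ 0 \pmod{q{\cal L}} & \text{otherwise,}\end{cases} $$ where $x\equiv y \pmod{q{\cal L}}$ means $x-y\in q{\cal L}$.
   Context: ${\cal F}_q[{\rm Mat}_n]$ is the associative algebra over $K(q)$ generated by $t_{ij}$, $1\le i,j\le n$, subject to: for $1\le i<j\le n$ and $1\le k<l\le n$, $t_{ik}t_{il}=q^{-1}t_{il}t_{ik}$, $t_{ik}t_{jk}=q^{-1}t_{jk}t_{ik}$, $t_{il}t_{jk}=t_{jk}t_{il}$, and $t_{ik}t_{jl}-t_{jl}t_{ik}=(q^{-1}-q)t_{il}t_{jk}$. For sequences $I=(i_1,\ldots,i_m)$, $J=(j_1,\ldots,j_m)$ the quantum minor is $\det_q T_{IJ}=\sum_{w\in S_m}(-q)^{-\ell(w)}t_{i_1j_{w_1}}\cdots t_{i_mj_{w_m}}$, where $\ell(w)$ is the number of inversions. Young tableaux are in French convention: entries in $\{1,\ldots,n\}$,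 rows weakly increasing from left to right, columns strictly increasing from bottom to top. For two Young tableaux $\tau,\tau'$ of the same shape with columns $c_1,\ldots,c_r$ and $c'_1,\ldots,c'_r$ (left to right), the quantum bitableau $(\tau\,|\,\tau')$ is the ordered product $\prod_{s=1}^r\det_q T_{c_s c'_s}$ (left to right), where a column is read as the increasing sequence of its entries. The quantum bitableaux form a $K(q)$-basis of ${\cal F}_q[{\rm Mat}_n]$, and ${\cal L}$ denotes the $K[q]$-submodule they span. The Robinson–Schensted correspondence sends a word $w$ to the pair $(P(w),Q(w))$ of its (row-)insertion tableau $P(w)$ (a Young tableau) and its recording tableau $Q(w)$ (a standard Young tableau of the same shape).
   Formalization: The relation t_ik t_il = q^{-1} t_il t_ik is imposed for every row i (k<l) and t_ik t_jk = q^{-1} t_jk t_ik for every column k (i<j), including i=n and k=n, which the literal range ''i<j and k<l'' leaves out and without which the claim fails. *)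

(* Defs.v *)
From HB Require Import structures.
From mathcomp Require Import all_boot all_order all_algebra all_fingroup.
Set Implicit Arguments. Unset Strict Implicit. Unset Printing Implicit Defensive.
Import GRing.Theory.
Local Open Scope ring_scope.

Section QMat.
Variable K : fieldType.
Variable n : nat.

Definition Kq := {fraction {poly K}}.
Definition qv : Kq := FracField.tofrac 'X.
Definition polyq (p : {poly K}) : Kq := FracField.tofrac p.

Definition qmat_rel (A : algType Kq) (t : 'I_n -> 'I_n -> A) : Prop :=
  [/\ (forall i k l : 'I_n, (k < l)%N -> t i k * t i l = qv^-1 *: (t i l * t i k)),
      (forall i j k : 'I_n, (i < j)%N -> t i k * t j k = qv^-1 *: (t j k * t i k)),
      (forall i j k l : 'I_n, (i < j)%N -> (k < l)%N -> t i l * t j k = t j k * t i l)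
    & (forall i j k l : 'I_n, (i < j)%N -> (k < l)%N ->
         t i k * t j l - t j l * t i k = (qv^-1 - qv) *: (t i l * t j k))].

Definition inv_count m (s : 'S_m) : nat :=
  #|[set ij : 'I_m * 'I_m | (ij.1 < ij.2)%N && (s ij.2 < s ij.1)%N]|.

Definition qdet (A : algType Kq) (t : 'I_n -> 'I_n -> A) (I J : seq 'I_n) : A :=
  \sum_(s : 'S_(size I))
     ((- qv)^-1) ^+ inv_count s *:
       \prod_(k < size I) t (tnth (in_tuple I) k) (nth (tnth (in_tuple I) k) J (s k)).

(* Tableaux in French convention: a list of rows, row 0 at the bottom. *)
Definition tableau := seq (seq 'I_n).

Definition row_below (r1 r2 : seq 'I_n) : bool :=
  (size r2 <= size r1)%N && all (fun p : 'I_n * 'I_n => (p.1 < p.2)%N) (zip r1 r2).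

Definition is_tab (T : tableau) : bool :=
  all (fun r => (r != [::]) && sorted (fun x y : 'I_n => (x <= y)%N) r) T
  && sorted row_below T.

Definition shape {X} (T : seq (seq X)) : seq nat := map size T.

(* s-th column (0-indexed, from the left), read from bottom to top. *)
Definition column (T : tableau) (s : nat) : seq 'I_n := pmap (fun r => onth r s) T.

Definition bitab (A : algType Kq) (t : 'I_n -> 'I_n -> A) (T T' : tableau) : A :=
  \prod_(s < size (head [::] T)) qdet t (column T s) (column T' s).

(* Schensted row insertion; returns the new tableau and the row of the new cell. *)
Fixpoint ins (x : 'I_n) (T : tableau) : tableau * nat :=
  match T with
  | [::] => ([:: [:: x]], 0%N)
  | r :: T' =>
      let i := find (fun y : 'I_n => (x < y)%N) r in
      if (i < size r)%N then
        let: (T2, k) := ins (nth x r i) T' in (set_nth x r i x :: T2, k.+1)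
      else (rcons r x :: T', 0%N)
  end.

Definition add_cell (Q : seq (seq nat)) (k m : nat) : seq (seq nat) :=
  if (k < size Q)%N then set_nth [::] Q k (rcons (nth [::] Q k) m)
  else rcons Q [:: m].

Definition RS_step (st : tableau * seq (seq nat) * nat) (x : 'I_n) :=
  let: (P, Q, m) := st in
  let: (P', k) := ins x P in (P', add_cell Q k m.+1, m.+1).

Definition RS (w : seq 'I_n) : tableau * seq (seq nat) :=
  let: (P, Q, _) := foldl RS_step ([::], [::], 0%N) w in (P, Q).

(* An element of F_q[Mat_n], given as a term built uniformly from the generators. *)
Definition qelem := forall (A : algType Kq), ('I_n -> 'I_n -> A) -> A.

(* z lies in q L: z = sum of q * c * bitableaux, c in K[q], in the algebra
   generated by the t_ij subject to the relations (equivalently: in every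
   K(q)-algebra with elements satisfying them). *)
Definition in_qL (z : qelem) : Prop :=
  exists s : seq (tableau * tableau * {poly K}),
    all (fun e => [&& is_tab e.1.1, is_tab e.1.2 & shape e.1.1 == shape e.1.2]) s /\
    forall (A : algType Kq) (t : 'I_n -> 'I_n -> A), qmat_rel t ->
      z A t = \sum_(e <- s) ((qv * polyq e.2) *: bitab t e.1.1 e.1.2).

Definition congr_qL (x y : qelem) : Prop := in_qL (fun A t => x A t - y A t).

Definition qmonomial (A : algType Kq) (t : 'I_n -> 'I_n -> A) (w u : seq 'I_n) : A :=
  \prod_(p <- zip w u) t p.1 p.2.

End QMat.

(* Main.v *)
(* Let M be the K[q]-span of all monomials t_{w,u}; it contains the lattice L spanned by the
   bitableaux.

   The defining relations say that the Hecke generators T_i act in the same way on the row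
   word w and on the column word u. Applying products of the operators q - T_i on both sides
   shows that, modulo qM, a monomial vanishes as soon as w has a descent where u has none, and
   is unchanged by a Knuth move performed on w and u at the same three positions. Row insertion
   is a sequence of such moves at positions determined by the recording tableau only, so
   t_{w,u} is congruent modulo qM to the monomial of the row reading words of P(w) and P(u) if
   Q(w) = Q(u), and to 0 otherwise. Moving the columns out of the row reading words by Knuth
   moves shows that this monomial is congruent to the bitableau, because a quantum minor is
   congruent to its antidiagonal monomial.

   This gives M = L + qM, hence M = L + q^N M for every N. Quantum straightening over
   K[q, 1/q] (Garnir relations on the first two columns, together with the braiding that moves
   a generator past a minor) gives q^N M in L for large N in each degree, so M = L and the
   congruences hold modulo qL. *)

Require Import Defs.
From HB Require Import structures.
From mathcomp Require Import all_boot all_order all_algebra all_fingroup.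
From mathcomp Require Import ring zify.
Set Implicit Arguments. Unset Strict Implicit. Unset Printing Implicit Defensive.
Import Order.TTheory GRing.Theory.
Local Open Scope ring_scope.

(** * Polynomial and Laurent polynomial scalars *)

Record is_subring (R : nzRingType) (S : R -> Prop) : Prop := IsSubring {
  subring1 : S 1;
  subringB : forall x y, S x -> S y -> S (x - y);
  subringM : forall x y, S x -> S y -> S (x * y) }.

Section SubringTheory.
Variables (R : nzRingType) (S : R -> Prop).
Hypothesis subringS : is_subring S.

Lemma subring0 : S 0.
Proof. by rewrite -(subrr 1); apply: (subringB subringS); apply: subring1. Qed.

Lemma subringN x : S x -> S (- x).
Proof. by move=> Sx; rewrite -sub0r; apply: (subringB subringS subring0). Qed.

Lemma subringD x y : S x -> S y -> S (x + y).
Proof. by move=> Sx /subringN Sy; rewrite -(opprK y); apply: (subringB subringS). Qed.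

Lemma subringX x m : S x -> S (x ^+ m).
Proof.
move=> Sx; elim: m => [|m IHm]; first exact: subring1.
by rewrite exprS; apply: (subringM subringS).
Qed.

End SubringTheory.

Section Scalars.
Variable K : fieldType.
Local Notation q := (qv K).

Lemma qv_neq0 : q != 0.
Proof. by rewrite tofrac_eq0 polyX_eq0. Qed.

Definition poly_scalar (c : Kq K) := exists p, c = polyq p.
Definition laurent_scalar (c : Kq K) := exists m, poly_scalar (q ^+ m * c).

Lemma poly_scalar_subring : is_subring poly_scalar.
Proof.
split; first by exists 1; rewrite /polyq tofrac1.
- by move=> _ _ [p ->] [r ->]; exists (p - r); rewrite /polyq tofracB.
- by move=> _ _ [p ->] [r ->]; exists (p * r); rewrite /polyq tofracM.
Qed.

Lemma poly_scalar_q : poly_scalar q.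
Proof. by exists 'X. Qed.

Lemma poly_scalar_qX m : poly_scalar (q ^+ m).
Proof. exact: subringX poly_scalar_subring _ _ poly_scalar_q. Qed.

Lemma laurent_poly_scalar c : poly_scalar c -> laurent_scalar c.
Proof. by exists 0%N; rewrite expr0 mul1r. Qed.

Lemma laurent_scalar_subring : is_subring laurent_scalar.
Proof.
have pR := poly_scalar_subring.
split; first exact: laurent_poly_scalar (subring1 pR).
- move=> c d [i ci] [j dj]; exists (i + j)%N.
  have -> : q ^+ (i + j) * (c - d) = q ^+ j * (q ^+ i * c) - q ^+ i * (q ^+ j * d).
    by rewrite exprD; ring.
  by apply: (subringB pR); apply: (subringM pR) => //; apply: poly_scalar_qX.
- move=> c d [i ci] [j dj]; exists (i + j)%N.
  have -> : q ^+ (i + j) * (c * d) = (q ^+ i * c) * (q ^+ j * d) by rewrite exprD; ring.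
  exact: (subringM pR).
Qed.

Lemma laurent_scalar_q : laurent_scalar q.
Proof. exact/laurent_poly_scalar/poly_scalar_q. Qed.

Lemma laurent_scalar_qV : laurent_scalar q^-1.
Proof. exists 1%N; rewrite expr1 divff ?qv_neq0 //; exact: subring1 poly_scalar_subring. Qed.

End Scalars.

Arguments poly_scalar {K} c.
Arguments laurent_scalar {K} c.

(** * Elements of the quantum matrix algebra *)

Section Elements.
Variables (K : fieldType) (n : nat).
Local Notation elt := (qelem K n).

(* An identity in the algebra with the given presentation is one that holds in all its models. *)
Definition qelem_eq (x y : elt) :=
  forall (A : algType (Kq K)) (t : 'I_n -> 'I_n -> A), qmat_rel t -> x A t = y A t.

Definition qzero : elt := fun A t => 0.
Definition qone : elt := fun A t => 1.
Definition qadd (x y : elt) : elt := fun A t => x A t + y A t.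
Definition qsub (x y : elt) : elt := fun A t => x A t - y A t.
Definition qscale (c : Kq K) (x : elt) : elt := fun A t => c *: x A t.
Definition qmul (x y : elt) : elt := fun A t => x A t * y A t.
Definition qgen (i j : 'I_n) : elt := fun A t => t i j.
Definition qmon (w u : seq 'I_n) : elt := fun A t => qmonomial t w u.

End Elements.

Declare Scope qelem_scope.
Delimit Scope qelem_scope with E.
Notation "0" := (@qzero _ _) : qelem_scope.
Notation "1" := (@qone _ _) : qelem_scope.
Notation "x + y" := (qadd x y) : qelem_scope.
Notation "x - y" := (qsub x y) : qelem_scope.
Notation "c *: x" := (qscale c x) : qelem_scope.
Notation "x * y" := (qmul x y) : qelem_scope.
Notation "x =~ y" := (qelem_eq x y) (at level 70, no associativity) : type_scope.

Arguments qmon {K n} w u.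
Arguments qgen {K n} i j.

Section Submodules.
Variables (K : fieldType) (n : nat).
Local Notation elt := (qelem K n).
Implicit Types (S : Kq K -> Prop) (G P : elt -> Prop) (x y z : elt).

Record submodule S P : Prop := Submodule {
  submod0 : P 0%E;
  submodD : forall x y, P x -> P y -> P (x + y)%E;
  submodZ : forall c x, S c -> P x -> P (c *: x)%E;
  submod_eq : forall x y, x =~ y -> P x -> P y }.

Inductive qspan S G : elt -> Prop :=
| qspan_gen g : G g -> qspan S G g
| qspan0 : qspan S G 0%E
| qspanD x y : qspan S G x -> qspan S G y -> qspan S G (x + y)%E
| qspanZ c x : S c -> qspan S G x -> qspan S G (c *: x)%E
| qspan_eq x y : x =~ y -> qspan S G x -> qspan S G y.

Lemma qspan_submodule S G : submodule S (qspan S G).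
Proof. by split; [exact: qspan0|exact: qspanD|exact: qspanZ|exact: qspan_eq]. Qed.

Lemma qspan_least S G P :
  submodule S P -> (forall g, G g -> P g) -> forall x, qspan S G x -> P x.
Proof.
case=> P0 PD PZ Peq GP x; elim=> {x} [g /GP //|//|x y _ Px _ Py|c x cS _ Px|x y xy _ Px].
- exact: PD.
- exact: PZ.
- exact: Peq xy Px.
Qed.

Lemma submodB S P x y : is_subring S -> submodule S P -> P x -> P y -> P (x - y)%E.
Proof.
move=> sS mP Px Py; have SN1 : S (-1) by apply: subringN (subring1 sS).
apply: (submod_eq mP _ (submodD mP Px (submodZ mP SN1 Py))) => A t _.
by rewrite /qadd /qscale scaleN1r.
Qed.

Lemma submod_sum S P (I : Type) (r : seq I) (Q : pred I) (F : I -> elt) :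
  submodule S P -> (forall i, Q i -> P (F i)) ->
  P (fun A t => \sum_(i <- r | Q i) F i A t).
Proof.
move=> mP PF; elim: r => [|i r IHr].
  by apply: (submod_eq mP) (submod0 mP) => A t _; rewrite big_nil.
case Qi: (Q i).
  by apply: (submod_eq mP) (submodD mP (PF i Qi) IHr) => A t _; rewrite big_cons Qi.
by apply: (submod_eq mP) IHr => A t _; rewrite big_cons Qi.
Qed.

Lemma submodule_mull S P z : submodule S P -> submodule S (fun x => P (z * x)%E).
Proof.
case=> P0 PD PZ Peq; split.
- by apply: Peq P0 => A t _; rewrite /qmul mulr0.
- by move=> x y Px Py; apply: Peq (PD _ _ Px Py) => A t _; rewrite /qmul /qadd mulrDr.
- by move=> c x cS Px; apply: Peq (PZ _ _ cS Px) => A t _; rewrite /qmul /qscale scalerAr.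
- by move=> x y xy Px; apply: Peq Px => A t rt; rewrite /qmul (xy A t rt).
Qed.

Lemma submodule_mulr S P z : submodule S P -> submodule S (fun x => P (x * z)%E).
Proof.
case=> P0 PD PZ Peq; split.
- by apply: Peq P0 => A t _; rewrite /qmul mul0r.
- by move=> x y Px Py; apply: Peq (PD _ _ Px Py) => A t _; rewrite /qmul /qadd mulrDl.
- by move=> c x cS Px; apply: Peq (PZ _ _ cS Px) => A t _; rewrite /qmul /qscale scalerAl.
- by move=> x y xy Px; apply: Peq Px => A t rt; rewrite /qmul (xy A t rt).
Qed.

Lemma submodule_scale S P c : submodule S P -> submodule S (fun x => P (c *: x)%E).
Proof.
case=> P0 PD PZ Peq; split.
- by apply: Peq P0 => A t _; rewrite /qscale scaler0.
- by move=> x y Px Py; apply: Peq (PD _ _ Px Py) => A t _; rewrite /qscale /qadd scalerDr.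
- move=> d x dS Px; apply: Peq (PZ _ _ dS Px) => A t _.
  by rewrite /qscale !scalerA mulrC.
- by move=> x y xy Px; apply: Peq Px => A t rt; rewrite /qscale (xy A t rt).
Qed.

End Submodules.

(** * The lattice of monomials *)

Section MonomialLattice.
Variables (K : fieldType) (n : nat).
Local Notation q := (qv K).
Local Notation elt := (qelem K n).
Implicit Types (S : Kq K -> Prop) (x y z : elt).

Section Monomials.
Variables (A : algType (Kq K)) (t : 'I_n -> 'I_n -> A).

Lemma qmonomial_nil : qmonomial t [::] [::] = 1.
Proof. by rewrite /qmonomial big_nil. Qed.

Lemma qmonomial_cons a w b u : qmonomial t (a :: w) (b :: u) = t a b * qmonomial t w u.
Proof. by rewrite /qmonomial big_cons. Qed.

Lemma qmonomial_cat w1 u1 w2 u2 : size w1 = size u1 ->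
  qmonomial t (w1 ++ w2) (u1 ++ u2) = qmonomial t w1 u1 * qmonomial t w2 u2.
Proof. by move=> s1; rewrite /qmonomial zip_cat // big_cat. Qed.

End Monomials.

Definition is_monomial k z := exists w u : seq 'I_n, [/\ size w = k, size u = k & z = qmon w u].

Definition mon_lattice S k := qspan S (is_monomial k).

Lemma mon_lattice_submodule S k : submodule S (mon_lattice S k).
Proof. exact: qspan_submodule. Qed.

Lemma mon_lattice_mon S k w u : size w = k -> size u = k -> mon_lattice S k (qmon w u).
Proof. by move=> sw su; apply: qspan_gen; exists w, u. Qed.

Lemma mon_lattice_gen S i j : mon_lattice S 1 (qgen i j).
Proof.
apply: (@qspan_eq _ _ _ _ (qmon [:: i] [:: j])) => [A t _|]; last exact: mon_lattice_mon.
by rewrite /qmon qmonomial_cons qmonomial_nil mulr1.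
Qed.

Lemma mon_latticeM S i j x y :
  mon_lattice S i x -> mon_lattice S j y -> mon_lattice S (i + j) (x * y)%E.
Proof.
move=> Mx My; move: x Mx; apply: qspan_least.
  exact/submodule_mulr/mon_lattice_submodule.
move=> _ [w [u [sw su ->]]]; move: y My; apply: qspan_least.
  exact/submodule_mull/mon_lattice_submodule.
move=> _ [w' [u' [sw' su' ->]]].
apply: (@qspan_eq _ _ _ _ (qmon (w ++ w') (u ++ u'))) => [A t _|].
  by rewrite /qmul /qmon qmonomial_cat // sw.
by apply: mon_lattice_mon; rewrite size_cat ?sw ?su ?sw' ?su'.
Qed.

Lemma laurent_mon_lattice k x : mon_lattice poly_scalar k x -> mon_lattice laurent_scalar k x.
Proof.
move: x; apply: qspan_least => [|g Gg]; last exact: qspan_gen.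
split; [exact: qspan0|exact: qspanD| |exact: qspan_eq].
by move=> c x cP; apply/qspanZ/laurent_poly_scalar.
Qed.

Definition vanish_mod_q k z := exists2 x, mon_lattice poly_scalar k x & z =~ (q *: x)%E.

Lemma vanish_submodule k : submodule poly_scalar (vanish_mod_q k).
Proof.
have mM := mon_lattice_submodule poly_scalar k; split.
- by exists 0%E; [exact: qspan0|move=> A t _; rewrite /qscale /qzero scaler0].
- move=> x y [x' Mx Ex] [y' My Ey]; exists (x' + y')%E; first exact: submodD mM _ _ _ _.
  by move=> A t rt; rewrite /qadd (Ex _ _ rt) (Ey _ _ rt) /qscale scalerDr.
- move=> c x cP [x' Mx Ex]; exists (c *: x')%E; first exact: submodZ mM _ _ _ _.
  by move=> A t rt; rewrite /qscale (Ex _ _ rt) /qscale !scalerA mulrC.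
- by move=> x y xy [x' Mx Ex]; exists x' => // A t rt; rewrite -(xy _ _ rt); apply: Ex.
Qed.

Lemma vanish_qZ k x : mon_lattice poly_scalar k x -> vanish_mod_q k (q *: x)%E.
Proof. by exists x. Qed.

Lemma vanishB k x y : vanish_mod_q k x -> vanish_mod_q k y -> vanish_mod_q k (x - y)%E.
Proof. exact: submodB (poly_scalar_subring K) (vanish_submodule k). Qed.

Lemma vanishMl i j x y :
  mon_lattice poly_scalar i x -> vanish_mod_q j y -> vanish_mod_q (i + j) (x * y)%E.
Proof.
move=> Mx [y' My Ey]; exists (x * y')%E; first exact: mon_latticeM.
by move=> A t rt; rewrite /qmul /qscale (Ey _ _ rt) /qscale scalerAr.
Qed.

Lemma vanishMr i j x y :
  vanish_mod_q i x -> mon_lattice poly_scalar j y -> vanish_mod_q (i + j) (x * y)%E.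
Proof.
move=> [x' Mx Ex] My; exists (x' * y)%E; first exact: mon_latticeM.
by move=> A t rt; rewrite /qmul /qscale (Ex _ _ rt) /qscale scalerAl.
Qed.

Definition cong_mod_q k x y := vanish_mod_q k (x - y)%E.

Lemma cong_eq k x y : x =~ y -> cong_mod_q k x y.
Proof.
move=> xy; apply: (submod_eq (vanish_submodule k)) (submod0 (vanish_submodule k)) => A t rt.
by rewrite /qsub (xy _ _ rt) subrr.
Qed.

Lemma cong_sym k x y : cong_mod_q k x y -> cong_mod_q k y x.
Proof.
move=> xy; have := vanishB (submod0 (vanish_submodule k)) xy.
by apply: (submod_eq (vanish_submodule k)) => A t _; rewrite /qsub /qzero sub0r opprB.
Qed.

Lemma cong_vanish k x y : cong_mod_q k x y -> vanish_mod_q k y -> vanish_mod_q k x.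
Proof.
move=> xy Vy; apply: (submod_eq (vanish_submodule k)) (submodD (vanish_submodule k) xy Vy) => A t _.
by rewrite /qadd /qsub subrK.
Qed.

Lemma cong_trans k y x z : cong_mod_q k x y -> cong_mod_q k y z -> cong_mod_q k x z.
Proof.
move=> xy yz; apply: (submod_eq (vanish_submodule k)) (submodD (vanish_submodule k) xy yz).
by move=> A t _; rewrite /qsub /qadd addrA subrK.
Qed.

Lemma congM i j x x' y y' :
  mon_lattice poly_scalar i x -> mon_lattice poly_scalar j y' ->
  cong_mod_q i x x' -> cong_mod_q j y y' -> cong_mod_q (i + j) (x * y)%E (x' * y')%E.
Proof.
move=> Mx My xx' yy'; have mV := vanish_submodule (i + j).
apply: (submod_eq mV) (submodD mV (vanishMl Mx yy') (vanishMr xx' My)).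
by move=> A t _; rewrite /qmul /qsub /qadd mulrBr mulrBl addrA subrK.
Qed.

End MonomialLattice.

Arguments mon_lattice_submodule {K n} S k.
Arguments vanish_submodule {K n} k.

(** * Hecke operators *)

Section WordMoves.
Variable n : nat.
Local Notation word := (seq 'I_n).
Implicit Types (a b : 'I_n) (w p : word).

Fixpoint swap_at i w : word :=
  match i, w with
  | 0, [:: a, b & v] => [:: b, a & v]
  | i'.+1, a :: v => a :: swap_at i' v
  | _, _ => w
  end.

Definition adjacent X (f : 'I_n -> 'I_n -> X) x0 i w :=
  if drop i w is [:: a, b & _] then f a b else x0.

Lemma adjacent_cons X (f : 'I_n -> 'I_n -> X) x0 i a w :
  adjacent f x0 i.+1 (a :: w) = adjacent f x0 i w.
Proof. by []. Qed.

Lemma size_swap_at i w : size (swap_at i w) = size w.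
Proof. by elim: i w => [|i IHi] [|a w] //=; [case: w|rewrite IHi]. Qed.

Lemma swap_atK i : involutive (swap_at i).
Proof. by elim: i => [|i IHi] [|a w] //=; [case: w|rewrite IHi]. Qed.

Lemma swap_at_cat i p w : swap_at (size p + i) (p ++ w) = p ++ swap_at i w.
Proof. by elim: p => //= a p ->. Qed.

Lemma adjacent_cat X (f : 'I_n -> 'I_n -> X) x0 i p w :
  adjacent f x0 (size p + i) (p ++ w) = adjacent f x0 i w.
Proof. by elim: p. Qed.

Lemma swap_at_catl i w p : (i.+1 < size w)%N -> swap_at i (w ++ p) = swap_at i w ++ p.
Proof.
elim: i w => [|i IHi] [|a w] //=; first by case: w.
by rewrite ltnS => /IHi ->.
Qed.

Lemma adjacent_catl X (f : 'I_n -> 'I_n -> X) x0 i w p : (i.+1 < size w)%N ->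
  adjacent f x0 i (w ++ p) = adjacent f x0 i w.
Proof.
elim: i w => [|i IHi] [|a w] //=; first by case: w.
by rewrite ltnS !adjacent_cons => /IHi ->.
Qed.

Lemma adjacent_split i w : (i.+1 < size w)%N ->
  exists p a b r, w = p ++ [:: a, b & r] /\ size p = i.
Proof.
move=> iw; exists (take i w); case wE: (drop i w) (size_drop i w) => [|a [|b r]] /= sd; try lia.
by exists a, b, r; rewrite -wE cat_take_drop size_takel //; lia.
Qed.

End WordMoves.

Section Hecke.
Variables (K : fieldType) (n : nat).
Local Notation q := (qv K).
Local Notation word := (seq 'I_n).

(* The Hecke generator T acts on two-letter words by T(ab) = ba + hecke_coef a b * ab. *)
Definition hecke_coef (a b : 'I_n) : Kq K :=
  if (a < b)%N then 0 else if a == b then q - 1 else q - q^-1.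

Lemma hecke_coef_lt (a b : 'I_n) : (a < b)%N -> hecke_coef a b = 0.
Proof. by rewrite /hecke_coef => ->. Qed.

Lemma hecke_coef_eq a : hecke_coef a a = q - 1.
Proof. by rewrite /hecke_coef ltnn eqxx. Qed.

Lemma hecke_coef_gt (a b : 'I_n) : (b < a)%N -> hecke_coef a b = q - q^-1.
Proof.
rewrite /hecke_coef => ba; rewrite ltnNge (ltnW ba) /=.
by case: eqP => // ab; rewrite ab ltnn in ba.
Qed.

Definition hecke (V : lmodType (Kq K)) i (F : word -> V) (w : word) : V :=
  F (swap_at i w) + adjacent hecke_coef 0 i w *: F w.

Lemma eq_hecke (V : lmodType (Kq K)) i (F G : word -> V) w :
  (forall v, size v = size w -> F v = G v) -> hecke i F w = hecke i G w.
Proof. by move=> FG; rewrite /hecke !FG ?size_swap_at. Qed.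

Lemma hecke_in_alg (A : lalgType (Kq K)) i (F : word -> (Kq K)^o) w :
  hecke i (fun u => (F u : Kq K)%:A : A) w = (hecke i F w : Kq K)%:A.
Proof. by rewrite /hecke scalerDl scalerA. Qed.

(* Diagonal coefficients of q - T. *)
Definition cohecke_coef a b := q - hecke_coef a b.

Lemma cohecke_coef_lt (a b : 'I_n) : (a < b)%N -> cohecke_coef a b = q.
Proof. by move=> ab; rewrite /cohecke_coef hecke_coef_lt ?subr0. Qed.

Lemma cohecke_coef_eq (a : 'I_n) : cohecke_coef a a = 1.
Proof. by rewrite /cohecke_coef hecke_coef_eq opprB addrC subrK. Qed.

Lemma cohecke_coef_gt (a b : 'I_n) : (b < a)%N -> cohecke_coef a b = q^-1.
Proof. by move=> ab; rewrite /cohecke_coef hecke_coef_gt // opprB addrC subrK. Qed.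

Lemma poly_cohecke_coef (a b : 'I_n) : (a <= b)%N -> poly_scalar (cohecke_coef a b).
Proof.
rewrite leq_eqVlt => /orP[/eqP/val_inj ->|ab].
  by rewrite cohecke_coef_eq; apply: subring1 (poly_scalar_subring K).
by rewrite cohecke_coef_lt //; apply: poly_scalar_q.
Qed.

Lemma cohecke_coef_rev_ord (a b : 'I_n) :
  cohecke_coef (rev_ord b) (rev_ord a) = cohecke_coef a b.
Proof.
rewrite /cohecke_coef /hecke_coef (inj_eq rev_ord_inj) (eq_sym b) /=.
by rewrite (_ : (n - b.+1 < n - a.+1)%N = (a < b)%N) //; have := ltn_ord b; lia.
Qed.

Definition cohecke (V : lmodType (Kq K)) i (F : word -> V) (w : word) : V :=
  adjacent cohecke_coef q i w *: F w - F (swap_at i w).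

Lemma coheckeE (V : lmodType (Kq K)) i (F : word -> V) w :
  cohecke i F w = q *: F w - hecke i F w.
Proof.
rewrite /cohecke /hecke.
have -> : adjacent cohecke_coef q i w = q - adjacent hecke_coef 0 i w.
  by rewrite /adjacent; case: drop => [|a [|b v]]; rewrite ?subr0.
by rewrite scalerBl opprD addrA addrAC.
Qed.

Section FRT.
Variables (A : algType (Kq K)) (t : 'I_n -> 'I_n -> A).
Hypothesis rt : qmat_rel t.

Lemma qmat_frt a b c d :
  t a d * t b c - t b c * t a d = (hecke_coef a b - hecke_coef c d) *: (t a c * t b d).
Proof.
case: rt => r1 r2 r3 r4.
have r1' (i k l : 'I_n) : (k < l)%N -> t i l * t i k = q *: (t i k * t i l).
  by move=> kl; rewrite (r1 i k l kl) scalerA divff ?scale1r ?qv_neq0.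
have r2' (i j k : 'I_n) : (i < j)%N -> t j k * t i k = q *: (t i k * t j k).
  by move=> ij; rewrite (r2 i j k ij) scalerA divff ?scale1r ?qv_neq0.
case: (ltngtP a b) => [ab|ba|/val_inj <-]; case: (ltngtP c d) => [cd|dc|/val_inj <-].
- by rewrite !hecke_coef_lt // subrr scale0r (r3 a b c d) // subrr.
- by rewrite (hecke_coef_lt ab) (hecke_coef_gt dc) sub0r opprB r4.
- by rewrite (hecke_coef_lt ab) hecke_coef_eq sub0r opprB (r2' a b c ab) scalerBl scale1r.
- rewrite (hecke_coef_gt ba) (hecke_coef_lt cd) subr0 -opprB r4 // (r3 b a c d) //.
  by rewrite -scaleNr opprB.
- by rewrite (hecke_coef_gt ba) (hecke_coef_gt dc) subrr scale0r (r3 b a d c) // subrr.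
- rewrite (hecke_coef_gt ba) hecke_coef_eq.
  have -> : q - q^-1 - (q - 1) = 1 - q^-1 by ring.
  by rewrite scalerBl scale1r -(r2 b a c).
- by rewrite hecke_coef_eq (hecke_coef_lt cd) subr0 (r1' a c d cd) scalerBl scale1r.
- rewrite hecke_coef_eq (hecke_coef_gt dc).
  have -> : q - 1 - (q - q^-1) = q^-1 - 1 by ring.
  by rewrite (r1 a d c dc) scalerBl scale1r.
- by rewrite !hecke_coef_eq !subrr scale0r.
Qed.

(* The defining relations say that T acts in the same way on row words and on column words. *)
Lemma hecke_qmonomial i w u : size w = size u ->
  hecke i (qmonomial t ^~ u) w = hecke i (qmonomial t w) u.
Proof.
rewrite /hecke; elim: i w u => [|i IHi] [|a w] [|c u] //= [su].
  case: w u su => [|b w] [|d u] //= _; rewrite !qmonomial_cons !mulrA !scalerAl -!mulrDl.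
  congr (_ * _); have /eqP := qmat_frt a b c d.
  by rewrite -!scalerAl subr_eq => /eqP ->; rewrite addrAC -scalerDl subrK addrC.
by rewrite !qmonomial_cons !adjacent_cons !scalerAr -!mulrDr (IHi _ _ su).
Qed.

Lemma cohecke_qmonomial i w u : size w = size u ->
  cohecke i (qmonomial t ^~ u) w = cohecke i (qmonomial t w) u.
Proof. by move=> su; rewrite !coheckeE hecke_qmonomial. Qed.

Lemma cohecke_cohecke_qmonomial i j w u : size w = size u ->
  cohecke j (cohecke i (qmonomial t ^~ u)) w = cohecke i (cohecke j (qmonomial t w)) u.
Proof.
move=> su; have su' : size w = size (swap_at i u) by rewrite size_swap_at.
rewrite -[LHS]/(_ *: cohecke i _ w - cohecke i _ (swap_at j w)).
rewrite -[RHS]/(_ *: cohecke j _ u - cohecke j _ (swap_at i u)).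
rewrite !cohecke_qmonomial ?size_swap_at //.
rewrite -!(cohecke_qmonomial j) // /cohecke !scalerBr !scalerA (mulrC (adjacent _ _ j w)).
by rewrite !opprB addrACA [RHS]addrACA; congr (_ + _); rewrite addrC.
Qed.

End FRT.
End Hecke.

(** * Knuth moves *)

Section KnuthPaths.
Variable n : nat.
Local Notation word := (seq 'I_n).
Implicit Types (w v u p s : word) (ks : seq nat).

Definition descent i w : bool := adjacent (fun a b : 'I_n => (b < a)%N) false i w.

(* For a <= b > c, the word that a Knuth relation identifies with abc. *)
Definition knuth (a b c : 'I_n) : word := if (c < a)%N then [:: a; c; b] else [:: b; a; c].

Definition knuth_step i w v := exists p (a b c : 'I_n) s,
  [/\ size p = i, (c < b)%N && (a <= b)%N, w = p ++ [:: a, b, c & s] & v = p ++ knuth a b c ++ s].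

(* The positions are recorded because the same moves have to be performed on two words. *)
Fixpoint knuth_path ks w v : Prop :=
  if ks is i :: ks' then exists2 w', knuth_step i w w' & knuth_path ks' w' v else w = v.

Lemma descent_cat i p w : descent (size p + i) (p ++ w) = descent i w.
Proof. exact: adjacent_cat. Qed.

Lemma size_knuth a b c : size (knuth a b c) = 3%N.
Proof. by rewrite /knuth; case: ifP. Qed.

Lemma knuth_step_catl p i w v : knuth_step i w v -> knuth_step (size p + i) (p ++ w) (p ++ v).
Proof.
case=> p' [a [b [c [s [<- abc -> ->]]]]]; exists (p ++ p'), a, b, c, s.
by rewrite size_cat -!catA.
Qed.

Lemma knuth_step_catr s i w v : knuth_step i w v -> knuth_step i (w ++ s) (v ++ s).
Proof.
case=> p [a [b [c [s' [<- abc -> ->]]]]]; exists p, a, b, c, (s' ++ s).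
by rewrite -!catA.
Qed.

Lemma knuth_path_trans ks ls w v u :
  knuth_path ks w v -> knuth_path ls v u -> knuth_path (ks ++ ls) w u.
Proof.
by elim: ks w => [|i ks IHks] w /=; [move->|case=> w' ww' /IHks wv /wv; exists w'].
Qed.

Lemma knuth_path_catl p ks w v : knuth_path ks w v ->
  knuth_path [seq (size p + i)%N | i <- ks] (p ++ w) (p ++ v).
Proof.
elim: ks w => [|i ks IHks] w /=; first by move->.
by case=> w' /(knuth_step_catl p) ww' /IHks; exists (p ++ w').
Qed.

Lemma knuth_path_catr s ks w v : knuth_path ks w v -> knuth_path ks (w ++ s) (v ++ s).
Proof.
elim: ks w => [|i ks IHks] w /=; first by move->.
by case=> w' /(knuth_step_catr s) ww' /IHks; exists (w' ++ s).
Qed.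

Lemma size_knuth_path ks w v : knuth_path ks w v -> size v = size w.
Proof.
elim: ks w => [|i ks IHks] w /=; first by move->.
case=> _ [p [a [b [c [s [_ _ -> ->]]]]]] /IHks ->.
by rewrite !size_cat size_knuth.
Qed.

Definition separated w u := exists ks i w' u',
  [/\ knuth_path ks w w', knuth_path ks u u', (i.+1 < size w)%N & descent i w' != descent i u'].

Lemma separated_descent i w u :
  (i.+1 < size w)%N -> descent i w != descent i u -> separated w u.
Proof. by exists [::], i, w, u. Qed.

Lemma separated_path ks w w' u u' :
  knuth_path ks w w' -> knuth_path ks u u' -> separated w' u' -> separated w u.
Proof.
move=> ww' uu' [ls [i [w'' [u'' [w'w'' u'u'' iw' wu'']]]]].
exists (ks ++ ls), i, w'', u''; rewrite -(size_knuth_path ww') iw'.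
by split=> //; [exact: knuth_path_trans w'w''|exact: knuth_path_trans u'u''].
Qed.

Lemma separated_catl s s' w u :
  size w = size u -> separated w u -> separated (w ++ s) (u ++ s').
Proof.
move=> swu [ks [i [w' [u' [ww' uu' iw wu']]]]]; exists ks, i, (w' ++ s), (u' ++ s').
split; [exact: knuth_path_catr|exact: knuth_path_catr|by rewrite size_cat ltn_addr|].
by rewrite /descent !adjacent_catl ?(size_knuth_path ww') ?(size_knuth_path uu') // -swu.
Qed.

End KnuthPaths.

Section KnuthCongruence.
Variables (K : fieldType) (n : nat).
Local Notation q := (qv K).
Local Notation elt := (qelem K n).
Local Notation qmon := (@qmon K n).
Local Notation word := (seq 'I_n).
Implicit Types (a b c : 'I_n) (w u : word).

Lemma cohecke_descent i w :
  if descent i w then adjacent (@cohecke_coef K n) q i w = q^-1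
  else poly_scalar (adjacent (@cohecke_coef K n) q i w).
Proof.
rewrite /descent /adjacent; case: drop => [|a [|b v]]; try exact: poly_scalar_q.
by case: ltnP => ab; [exact: cohecke_coef_gt|exact: poly_cohecke_coef].
Qed.

Lemma vanish_descent i w u : size w = size u -> descent i w != descent i u ->
  vanish_mod_q (size w) (qmon w u).
Proof.
move=> swu; have mM := @mon_lattice_submodule K n poly_scalar (size w).
have mon w' u' : size w' = size w -> size u' = size w ->
    mon_lattice poly_scalar (size w) (qmon w' u').
  exact: mon_lattice_mon.
have Mwu : mon_lattice poly_scalar (size w) (qmon w u) by apply: mon.
have Mw : mon_lattice poly_scalar (size w) (qmon w (swap_at i u)).
  by apply: mon; rewrite ?size_swap_at.
have Mu : mon_lattice poly_scalar (size w) (qmon (swap_at i w) u).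
  by apply: mon; rewrite ?size_swap_at.
have vanish (d : Kq K) (x y : elt) : poly_scalar d ->
    mon_lattice poly_scalar (size w) x -> mon_lattice poly_scalar (size w) y ->
    (q^-1 *: qmon w u - x)%E =~ (d *: qmon w u - y)%E -> vanish_mod_q (size w) (qmon w u).
  move=> dP Mx My xy; exists (d *: qmon w u + (x - y))%E.
    by apply: (submodD mM); [apply: (submodZ mM)|apply: (submodB (poly_scalar_subring K) mM)].
  move=> A t /xy; rewrite /qsub /qscale => /eqP; rewrite subr_eq => /eqP.
  move/(congr1 ( *:%R q)); rewrite scalerA divff ?qv_neq0 // scale1r => ->.
  by rewrite /qadd addrAC addrA.
have := cohecke_descent i w; have := cohecke_descent i u.
case: (descent i w); case: (descent i u) => // u_coef w_coef _.
- apply: (vanish _ _ _ u_coef Mu Mw) => A t rt.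
  by have := cohecke_qmonomial rt i swu; rewrite /cohecke w_coef.
- apply: (vanish _ _ _ w_coef Mw Mu) => A t rt.
  by have := cohecke_qmonomial rt i swu; rewrite /cohecke u_coef.
Qed.

(* The combination is q (q - T_2)(q - T_1) applied to x0 = F(abc), where x1 = F(bac),
   x2 = F(acb) and x3 = F(cab); modulo q it reduces to minus the value of F at the
   Knuth move of abc. *)
Lemma vanish_knuth_combination k a b c (x0 x1 x2 x3 : elt) : (c < b)%N && (a <= b)%N ->
  mon_lattice poly_scalar k x0 -> mon_lattice poly_scalar k x2 -> mon_lattice poly_scalar k x3 ->
  (a = b -> x0 =~ x1) -> ((c < a < b)%N -> vanish_mod_q k x1) ->
  vanish_mod_q k (q *: (cohecke_coef K b c *: (cohecke_coef K a b *: x0 - x1)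
                        - (cohecke_coef K a c *: x2 - x3)) + (if (c < a)%N then x2 else x1))%E.
Proof.
case/andP=> cb ab Mx0 Mx2 Mx3 x01 Vx1.
have [mM mV] := (@mon_lattice_submodule K n poly_scalar k, @vanish_submodule K n k).
have q0 := qv_neq0 K; case: ltnP => [ca|ac]; last first.
  have ab' : (a < b)%N := leq_ltn_trans ac cb.
  have Mx : mon_lattice poly_scalar k (x0 - (cohecke_coef K a c *: x2 - x3))%E.
    apply: (submodB (poly_scalar_subring K) mM) => //.
    by apply: (submodB (poly_scalar_subring K) mM) => //; apply/(submodZ mM)/Mx2/poly_cohecke_coef.
  apply: (submod_eq mV _ (vanish_qZ Mx)) => A t _; rewrite /qscale /qsub /qadd.
  rewrite (cohecke_coef_gt K cb) (cohecke_coef_lt K ab') [q *: (q^-1 *: _ - _)]scalerBr scalerA.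
  by rewrite divff // scale1r addrAC subrK -scalerBr.
have Vx : vanish_mod_q k (cohecke_coef K a b *: x0 - x1)%E.
  move: ab; rewrite leq_eqVlt => /orP[/eqP/val_inj ab|ab].
    apply: (submod_eq mV _ (submod0 mV)) => A t rt.
    by rewrite /qsub /qscale ab cohecke_coef_eq scale1r (x01 ab A t rt) subrr.
  by rewrite cohecke_coef_lt //; apply: vanishB (vanish_qZ Mx0) (Vx1 _); rewrite ca.
apply: (submod_eq mV _ (submodD mV Vx (vanish_qZ Mx3))) => A t _; rewrite /qscale /qsub /qadd.
rewrite (cohecke_coef_gt K cb) (cohecke_coef_gt K ca) [q *: (q^-1 *: _ - _)]scalerBr scalerA.
by rewrite divff // scale1r scalerBr scalerA divff // scale1r opprB addrA subrK.
Qed.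

Section Windows.
Variables (V : lmodType (Kq K)) (F : word -> V) (p s : word) (a b c : 'I_n).
Local Notation at3 x y z := (F (p ++ [:: x, y, z & s])).

Lemma cohecke_window12 :
  cohecke (size p + 1) (cohecke (size p + 0) F) (p ++ [:: a, b, c & s])
  = cohecke_coef K b c *: (cohecke_coef K a b *: at3 a b c - at3 b a c)
    - (cohecke_coef K a c *: at3 a c b - at3 c a b).
Proof. by rewrite /cohecke !swap_at_cat !adjacent_cat. Qed.

Lemma cohecke_window21 :
  cohecke (size p + 0) (cohecke (size p + 1) F) (p ++ [:: a, b, c & s])
  = cohecke_coef K a b *: (cohecke_coef K b c *: at3 a b c - at3 a c b)
    - (cohecke_coef K a c *: at3 b a c - at3 b c a).
Proof. by rewrite /cohecke !swap_at_cat !adjacent_cat. Qed.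

End Windows.

Definition knuth_inv a b c : word := if (a <= c)%N then [:: a; c; b] else [:: b; a; c].

Lemma knuthK a b c : (c < b)%N && (a <= b)%N ->
  exists x y z, [/\ knuth a b c = [:: x; y; z], (y < x)%N && (y <= z)%N
                  & knuth_inv x y z = [:: a; b; c]].
Proof.
rewrite /knuth /knuth_inv => /andP[cb ab]; case: ltnP => [ca|ac].
  by exists a, c, b; rewrite ca (ltnW cb) ab.
by exists b, a, c; rewrite (leq_ltn_trans ac cb) ac leqNgt cb.
Qed.

Lemma size_cat3 p s (d e f d' e' f' : 'I_n) :
  size (p ++ [:: d', e', f' & s]) = size (p ++ [:: d, e, f & s]).
Proof. by rewrite !size_cat. Qed.

Lemma vanish_knuth_rows p s a b c u : size (p ++ [:: a, b, c & s]) = size u ->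
  (c < b)%N && (a <= b)%N -> ~~ descent (size p + 1) u ->
  vanish_mod_q (size u) (fun A t =>
    q *: cohecke (size p + 1) (cohecke (size p + 0) (qmonomial t ^~ u)) (p ++ [:: a, b, c & s])
    + qmonomial t (p ++ knuth a b c ++ s) u).
Proof.
move=> su abc du; have su' d e f : size (p ++ [:: d, e, f & s]) = size u.
  by rewrite (size_cat3 _ _ a b c).
have M d e f : mon_lattice poly_scalar (size u) (qmon (p ++ [:: d, e, f & s]) u).
  exact: mon_lattice_mon.
apply: (submod_eq (vanish_submodule _) _
  (@vanish_knuth_combination _ a b c _ (qmon (p ++ [:: b, a, c & s]) u) _ _ abc
     (M a b c) (M a c b) (M c a b) _ _)).
- by move=> A t _; rewrite cohecke_window12 /knuth; case: ltnP.
- by move=> ->.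
- case/andP=> ca ab; rewrite -(su' b a c); apply: (@vanish_descent (size p + 1)) => //.
  by rewrite descent_cat (negPf du) eqbF_neg negbK.
Qed.

Lemma vanish_knuth_columns p s a b c w : size w = size (p ++ [:: a, b, c & s]) ->
  (b < a)%N && (b <= c)%N -> ~~ descent (size p + 0) w ->
  vanish_mod_q (size w) (fun A t =>
    q *: cohecke (size p + 0) (cohecke (size p + 1) (qmonomial t w)) (p ++ [:: a, b, c & s])
    + qmonomial t w (p ++ knuth_inv a b c ++ s)).
Proof.
move=> sw abc dw; have sw' d e f : size (p ++ [:: d, e, f & s]) = size w.
  by rewrite (size_cat3 _ _ a b c).
have M d e f : mon_lattice poly_scalar (size w) (qmon w (p ++ [:: d, e, f & s])).
  exact: mon_lattice_mon.
have rev_lt (x y : 'I_n) : (rev_ord x < rev_ord y)%N = (y < x)%N.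
  by rewrite /=; have := ltn_ord x; have := ltn_ord y; lia.
have rev_le (x y : 'I_n) : (rev_ord x <= rev_ord y)%N = (y <= x)%N.
  by rewrite leqNgt rev_lt -leqNgt.
have abc' : (rev_ord a < rev_ord b)%N && (rev_ord c <= rev_ord b)%N.
  by rewrite (rev_lt a b) (rev_le c b).
apply: (submod_eq (vanish_submodule _) _
  (@vanish_knuth_combination _ (rev_ord c) (rev_ord b) (rev_ord a) _
     (qmon w (p ++ [:: a, c, b & s])) _ _ abc' (M a b c) (M b a c) (M b c a) _ _)).
- move=> A t _; rewrite cohecke_window21 /knuth_inv /qadd /qscale /qsub /qmon.
  by rewrite !cohecke_coef_rev_ord rev_lt; case: leqP.
- by move/rev_ord_inj->.
- rewrite !rev_lt => /andP[ca bc]; apply: (@vanish_descent (size p + 0)); first by rewrite sw'.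
  by rewrite descent_cat (negPf dw) eq_sym eqbF_neg negbK.
Qed.

Lemma cong_knuth_step i w w' u u' : size w = size u ->
  knuth_step i w w' -> knuth_step i u u' -> cong_mod_q (size w) (qmon w u) (qmon w' u').
Proof.
move=> swu [p [a [b [c [s [<- abc wE ->]]]]]] [p' [x [y [z [s' [sp xyz uE ->]]]]]].
have [x' [y' [z' [kE xyz' kinvE]]]] := knuthK xyz; rewrite {}kE.
pose v := p' ++ [:: x', y', z' & s'].
have sv : size (p ++ [:: a, b, c & s]) = size v by rewrite -wE swu uE (size_cat3 _ _ x' y' z').
have dv : ~~ descent (size p + 1) v.
  by rewrite -sp descent_cat -leqNgt; case/andP: xyz'.
have dw : ~~ descent (size p' + 0) w.
  by rewrite wE sp descent_cat -leqNgt; case/andP: abc.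
have row := vanish_knuth_rows sv abc dv; rewrite -sv -wE in row.
have col := vanish_knuth_columns (etrans (congr1 size wE) sv) xyz' dw.
apply: (submod_eq (vanish_submodule _) _ (vanishB col row)) => A t rt.
rewrite /qsub /qmon (cohecke_cohecke_qmonomial rt) ?sp ?kinvE -?uE ?(etrans (congr1 size wE) sv) //.
by rewrite opprD addrACA subrr add0r.
Qed.

Lemma cong_knuth_path ks w w' u u' : size w = size u ->
  knuth_path ks w w' -> knuth_path ks u u' -> cong_mod_q (size w) (qmon w u) (qmon w' u').
Proof.
elim: ks w u => [|i ks IHks] w u swu /=; first by move=> <- <-; apply: cong_eq.
case=> v wv vw' [v' uv' v'u']; apply: cong_trans (cong_knuth_step swu wv uv') _.
have sv : size v = size w by apply: (@size_knuth_path n [:: i]); exists v.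
have sv' : size v' = size u by apply: (@size_knuth_path n [:: i]); exists v'.
by rewrite -sv; apply: IHks; rewrite ?sv ?sv'.
Qed.

Lemma vanish_separated w u : size w = size u -> separated w u -> vanish_mod_q (size w) (qmon w u).
Proof.
move=> swu [ks [i [w' [u' [ww' uu' _ /vanish_descent dwu]]]]].
apply: cong_vanish (cong_knuth_path swu ww' uu') _.
by rewrite -(size_knuth_path ww'); apply: dwu; rewrite (size_knuth_path ww') (size_knuth_path uu').
Qed.

End KnuthCongruence.

(** * Row insertion *)

Section RowInsertion.
Variable n : nat.
Local Notation word := (seq 'I_n).
Local Notation leI := (fun x y : 'I_n => (x <= y)%N).
Implicit Types (a b c x y : 'I_n) (r s : word).

Definition bumped x r : 'I_n := nth x r (find (fun y => (x < y)%N) r).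

Fixpoint row_ins x r : word :=
  if r is c :: r' then if (x < c)%N then x :: r' else c :: row_ins x r' else [:: x].

Lemma set_nth_row_ins x r : let i := find (fun y => (x < y)%N) r in
  (i < size r)%N -> set_nth x r i x = row_ins x r.
Proof. by elim: r => //= c r IHr; case: (ltnP x c) => //= _ h; rewrite IHr. Qed.

Lemma row_ins_rcons x r : ~~ has (fun y => (x < y)%N) r -> row_ins x r = rcons r x.
Proof. by elim: r => //= c r IHr; rewrite negb_or => /andP[/negPf-> /IHr->]. Qed.

Lemma row_insP x r : has (fun y => (x < y)%N) r ->
  exists r1 b r2, [/\ r = r1 ++ b :: r2, all (fun y => (y <= x)%N) r1, (x < b)%N,
                      bumped x r = b & row_ins x r = r1 ++ x :: r2].
Proof.
rewrite /bumped; elim: r => //= a r IHr.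
case: (ltnP x a) => [xa _|ax /= /IHr[r1 [b [r2 [-> r1x xb bE rE]]]]].
  by exists [::], a, r.
by exists (a :: r1), b, r2; rewrite /= ax r1x bE rE.
Qed.

Lemma size_row_ins x r : has (fun y => (x < y)%N) r -> size (row_ins x r) = size r.
Proof. by case/row_insP=> r1 [b [r2 [-> _ _ _ ->]]]; rewrite !size_cat. Qed.

Lemma insE x r T : ins x (r :: T) =
  if has (fun y => (x < y)%N) r
  then (row_ins x r :: (ins (bumped x r) T).1, (ins (bumped x r) T).2.+1)
  else (row_ins x r :: T, 0%N).
Proof.
case: ifPn => [h|h] /=; last by rewrite -has_find (negPf h) row_ins_rcons.
by rewrite -has_find h set_nth_row_ins -?has_find // /bumped; case: ins.
Qed.

Lemma ins_row_le_size x T : ((ins x T).2 <= size T)%N.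
Proof. by elim: T x => // r T IHT x; rewrite insE; case: has => //=; rewrite ltnS. Qed.

Lemma rev_iotaS m : rev (iota 0 m.+1) = [seq (1 + i)%N | i <- rev (iota 0 m)] ++ [:: 0%N].
Proof. by rewrite map_rev -iotaDl cats1 -rev_cons. Qed.

Lemma knuth_path1 a b c s : (c < b)%N && (a <= b)%N ->
  knuth_path [:: 0%N] [:: a, b, c & s] (knuth a b c ++ s).
Proof. by move=> abc; exists (knuth a b c ++ s) => //; exists [::], a, b, c, s. Qed.

Lemma inserted_letter_path b r x : (x < b)%N -> path leI b r ->
  knuth_path (rev (iota 0 (size r))) (b :: rcons r x) [:: b, x & r].
Proof.
elim: r b => [|z r IHr] b xb //= /andP[bz zr]; rewrite rev_iotaS.
apply: knuth_path_trans (knuth_path_catl [:: b] (IHr z (leq_trans xb bz) zr)) _.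
have := @knuth_path1 b z x r; rewrite bz (leq_trans xb bz) /knuth xb.
exact.
Qed.

Lemma bumped_letter_path r b x s : all (fun y => (y <= x)%N) r -> (x < b)%N -> sorted leI r ->
  knuth_path (rev (iota 0 (size r))) (r ++ [:: b, x & s]) (b :: r ++ x :: s).
Proof.
elim: r => [|a r IHr] //= /andP[ax rx] xb ar; rewrite rev_iotaS.
apply: knuth_path_trans (knuth_path_catl [:: a] (IHr rx xb (path_sorted ar))) _.
have ab : (a <= b)%N := leq_trans ax (ltnW xb).
case: r rx ar {IHr} => [|a' r] /=.
  by have := @knuth_path1 a b x s; rewrite xb ab /knuth ltnNge ax => step _ _; apply: step.
move=> /andP[a'x _] /andP[aa' _].
have := @knuth_path1 a b a' (r ++ x :: s).
by rewrite (leq_ltn_trans a'x xb) ab /knuth ltnNge aa'; apply.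
Qed.

Lemma row_ins_path x r : sorted leI r -> has (fun y => (x < y)%N) r ->
  knuth_path (rev (iota 0 (size r).-1)) (rcons r x) (bumped x r :: row_ins x r).
Proof.
move=> Sr /row_insP[r1 [b [r2 [rE r1x xb -> ->]]]].
have [Sr1 br2] : sorted leI r1 /\ path leI b r2 by move: Sr; rewrite rE => /cat_sorted2[].
have -> : rev (iota 0 (size r).-1)
    = [seq (size r1 + i)%N | i <- rev (iota 0 (size r2))] ++ rev (iota 0 (size r1)).
  by rewrite rE size_cat addnS /= iotaD rev_cat map_rev -iotaDl addn0.
apply: knuth_path_trans (bumped_letter_path _ r1x xb Sr1).
by rewrite rE rcons_cat; apply/knuth_path_catl/inserted_letter_path.
Qed.

Lemma eq_size_shape (X Y : Type) (T : seq (seq X)) (T' : seq (seq Y)) :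
  shape T = shape T' -> size T = size T'.
Proof. by move/(congr1 size); rewrite !size_map. Qed.

Definition row_word (T : tableau n) : word := flatten (rev T).

Lemma row_word_cons r T : row_word (r :: T) = row_word T ++ r.
Proof. by rewrite /row_word rev_cons -cats1 flatten_cat /= cats0. Qed.

Lemma row_word_rcons r T : row_word (rcons T r) = r ++ row_word T.
Proof. by rewrite /row_word rev_rcons. Qed.

Lemma size_row_word T : size (row_word T) = sumn (shape T).
Proof. by elim: T => //= r T IHT; rewrite row_word_cons size_cat IHT addnC. Qed.

Lemma size_row_word_ins x T : size (row_word (ins x T).1) = (size (row_word T)).+1.
Proof.
elim: T x => //= r T IHT x; rewrite -/(ins x (r :: T)) insE.
case: ifPn => h; rewrite !row_word_cons !size_cat.
  by rewrite IHT size_row_ins.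
by rewrite row_ins_rcons // size_rcons addnS.
Qed.

Lemma rcons_row_word_path x r T : sorted leI r -> has (fun y => (x < y)%N) r ->
  knuth_path [seq (size (row_word T) + i)%N | i <- rev (iota 0 (size r).-1)]
    (rcons (row_word (r :: T)) x) (rcons (row_word T) (bumped x r) ++ row_ins x r).
Proof.
by move=> Sr h; rewrite row_word_cons rcons_cat cat_rcons; apply/knuth_path_catl/row_ins_path.
Qed.

Definition sorted_rows (T : tableau n) := all (fun r => (r != [::]) && sorted leI r) T.

Lemma ins_knuth_path sh k : exists ks, forall (T : tableau n) x,
  shape T = sh -> sorted_rows T -> (ins x T).2 = k ->
  knuth_path ks (rcons (row_word T) x) (row_word (ins x T).1).
Proof.
elim: sh k => [|m sh IHsh] k.
  by exists [::] => -[|? ?] // x _ _ _.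
case: k => [|k].
  exists [::] => -[|r T] // x _ _; rewrite insE; case: ifPn => // h _ /=.
  by rewrite !row_word_cons row_ins_rcons // rcons_cat.
have [ks insP] := IHsh k.
exists ([seq (sumn sh + i)%N | i <- rev (iota 0 m.-1)] ++ ks) => -[|r T] // x [<- sT].
case/andP=> /andP[_ Sr] ST; rewrite insE; case: ifP => // h [kE].
rewrite -sT -size_row_word; apply: knuth_path_trans (rcons_row_word_path T Sr h) _.
by rewrite [_.1]/= row_word_cons; apply: knuth_path_catr; apply: insP.
Qed.

Lemma has_gt_sorted_rcons x z r : sorted leI (rcons r z) ->
  has (fun y => (x < y)%N) (rcons r z) = (x < z)%N.
Proof.
move=> Sr; rewrite has_rcons; case: ltnP => //= zx; apply/hasPn=> a ar.
rewrite -leqNgt; apply: leq_trans zx; move: Sr.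
rewrite -cats1 (sorted_pairwise le_trans) pairwise_cat.
by case/and3P=> /allrelP/(_ a z ar (mem_head _ _)).
Qed.

Lemma descent_rcons_row x r : r != [::] -> sorted leI r ->
  descent (size r).-1 (rcons r x) = has (fun y => (x < y)%N) r.
Proof.
case/lastP: r => // r z _ Sr; rewrite has_gt_sorted_rcons // size_rcons -!cats1 -catA.
by rewrite -[_.-1]addn0 descent_cat.
Qed.

Lemma separated_ins (T T' : tableau n) x x' : shape T = shape T' ->
  sorted_rows T -> sorted_rows T' -> (ins x T).2 != (ins x' T').2 ->
  separated (rcons (row_word T) x) (rcons (row_word T') x').
Proof.
elim: T T' x x' => [|r T IHT] [|r' T'] // x x' [sr sT].
case/andP=> /andP[r0 Sr] ST /andP[/andP[r0' Sr'] ST']; rewrite !insE.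
have sT' : size (row_word T) = size (row_word T') by rewrite !size_row_word sT.
have r_descent : has (fun y => (x < y)%N) r != has (fun y => (x' < y)%N) r' ->
    separated (rcons (row_word (r :: T)) x) (rcons (row_word (r' :: T')) x').
  move=> has_neq; apply: (@separated_descent _ (size (row_word T) + (size r).-1)).
    by rewrite row_word_cons size_rcons size_cat ltnS -addnS leq_add2l prednK // lt0n size_eq0.
  rewrite {2}sr {2}sT' !row_word_cons !rcons_cat.
  by rewrite !descent_cat !descent_rcons_row.
case: ifPn => h; case: ifPn => h'; rewrite ?eqSS => //= ins2;
  try by apply: r_descent; rewrite ?h ?(negPf h) ?h' ?(negPf h').
have := rcons_row_word_path T' Sr' h'; rewrite -sr -sT' => path'.
apply: separated_path (rcons_row_word_path T Sr h) path' _.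
by apply: separated_catl (IHT _ _ _ sT ST ST' ins2); rewrite !size_rcons sT'.
Qed.

End RowInsertion.

(** * Robinson-Schensted *)

Section RobinsonSchensted.
Variable n : nat.
Local Notation word := (seq 'I_n).
Local Notation leI := (fun x y : 'I_n => (x <= y)%N).
Implicit Types (a b c x y : 'I_n) (r s u w : word) (T : tableau n).

Lemma row_ins_path_le x c r : (c <= x)%N -> path leI c r -> path leI c (row_ins x r).
Proof.
elim: r c => [|d r IHr] c cx /=; first by rewrite cx.
case/andP=> cd dr; case: ltnP => [xd|dx] /=; last by rewrite cd IHr.
by rewrite cx; case: r dr {IHr} => //= e r /andP[de ->]; rewrite andbT (leq_trans (ltnW xd)).
Qed.

Lemma sorted_row_ins x r : sorted leI r -> sorted leI (row_ins x r).
Proof.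
case: r => //= c r cr; case: ltnP => [xc|cx] /=; last exact: row_ins_path_le.
by case: r cr => //= d r /andP[cd ->]; rewrite andbT (leq_trans (ltnW xc)).
Qed.

Lemma row_below_cons a b r s :
  row_below (a :: r) (b :: s) = (a < b)%N && row_below r s.
Proof. by rewrite /row_below /= ltnS andbCA. Qed.

Lemma row_below0 r : row_below r [::].
Proof. by case: r. Qed.

Lemma row_below_decr p r s x y : (x < y)%N ->
  row_below (p ++ y :: r) s -> row_below (p ++ x :: r) s.
Proof.
move=> xy; elim: p s => [|c p IHp] [|d s] //=; rewrite ?row_below0 // !row_below_cons.
  by case/andP=> yd ->; rewrite (ltn_trans xy yd).
by case/andP=> -> /IHp.
Qed.

Lemma row_below_rcons r s x : row_below r s -> row_below (rcons r x) s.
Proof.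
elim: r s => [|c r IHr] [|d s] //=; rewrite ?row_below0 // !row_below_cons.
by case/andP=> -> /IHr.
Qed.

Lemma row_below_row_ins r1 r2 r x y : all (fun z : 'I_n => (z <= x)%N) r1 -> (x < y)%N ->
  row_below (r1 ++ y :: r2) r -> row_below (r1 ++ x :: r2) (row_ins y r).
Proof.
move=> r1x xy; elim: r1 r1x r => [_|c r1 IHr1 /= /andP[cx r1x]] [|d r] /=.
- by rewrite row_below_cons xy !row_below0.
- by rewrite row_below_cons => /andP[yd br]; rewrite yd row_below_cons xy.
- by rewrite row_below_cons !row_below0 (leq_ltn_trans cx xy).
- rewrite row_below_cons => /andP[cd abr]; case: ltnP => yd; rewrite row_below_cons.
    by rewrite (leq_ltn_trans cx xy) (row_below_decr xy).
  by rewrite cd IHr1.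
Qed.

Lemma is_tab_cons r T :
  is_tab (r :: T) = [&& r != [::], sorted leI r, row_below r (head [::] T) & is_tab T].
Proof.
have -> : is_tab (r :: T) = ((r != [::]) && sorted leI r && sorted_rows T)
    && (row_below r (head [::] T) && sorted (@row_below n) T).
  by case: T => [|r' T]; rewrite /is_tab //= row_below0.
by rewrite andbACA -!andbA.
Qed.

Lemma head_ins x T : head [::] (ins x T).1 = row_ins x (head [::] T).
Proof. by case: T => [|r T] //; rewrite insE; case: ifP. Qed.

Lemma row_ins_nil x r : (row_ins x r == [::]) = false.
Proof. by case: r => //= c r; case: ifP. Qed.

Lemma is_tab_ins x T : is_tab T -> is_tab (ins x T).1.
Proof.
elim: T x => //= r T IHT x; rewrite is_tab_cons => /and4P[r0 Sr rT tT].
rewrite -/(ins x (r :: T)) insE; case: ifPn => h;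
  rewrite [_.1]/= is_tab_cons row_ins_nil sorted_row_ins //.
  rewrite head_ins IHT // andbT /=.
  have [r1 [b [r2 [rE r1x xb -> ->]]]] := row_insP h.
  by rewrite row_below_row_ins // -rE.
by rewrite tT andbT row_ins_rcons // row_below_rcons.
Qed.

Lemma add_cell_cons p Q k m :
  add_cell (p :: Q) k m = if k is k'.+1 then p :: add_cell Q k' m else rcons p m :: Q.
Proof. by case: k => // k; rewrite /add_cell /= ltnS; case: ifP. Qed.

Lemma shape_ins x T Q m : shape T = shape Q ->
  shape (ins x T).1 = shape (add_cell Q (ins x T).2 m).
Proof.
elim: T x Q => [|r T IHT] x [|s Q] // [rs TQ].
rewrite insE; case: ifPn => h; rewrite add_cell_cons /=.
  by rewrite size_row_ins // rs -(IHT _ _ TQ).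
by rewrite row_ins_rcons // !size_rcons rs TQ.
Qed.

Definition entries_le m (Q : seq (seq nat)) :=
  all (fun p => (p != [::]) && all (fun e => e <= m)%N p) Q.

Lemma add_cellK Q k m : entries_le m Q ->
  [seq p <- [seq [seq e <- p | (e <= m)%N] | p <- add_cell Q k m.+1] | p != [::]] = Q.
Proof.
elim: Q k => [|r Q IHQ] k; first by rewrite /add_cell /= ltnn.
move=> /= /andP[/andP[r0 rm] Qm]; have IHQk k' := IHQ k' Qm.
rewrite add_cell_cons; case: k => [|k] /=; last by rewrite (all_filterP rm) r0 IHQk.
rewrite filter_rcons ltnn (all_filterP rm) r0; congr (_ :: _).
elim: Q Qm {IHQ IHQk} => //= s Q IHQ /andP[/andP[s0 sm] /IHQ->].
by rewrite (all_filterP sm) s0.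
Qed.

Lemma find_add_cell Q k m : entries_le m Q -> (k <= size Q)%N ->
  find (fun p => m.+1 \in p) (add_cell Q k m.+1) = k.
Proof.
elim: Q k => [|p Q IHQ] k; first by case: k => //= _ _; rewrite mem_head.
case/andP=> /andP[_ pm] Qm; rewrite add_cell_cons; case: k => [|k] /= kQ.
  by rewrite mem_rcons mem_head.
by rewrite IHQ //; case: ifP => // /(allP pm); rewrite ltnn.
Qed.

Lemma add_cell_inj Q Q' k k' m : entries_le m Q -> entries_le m Q' ->
  (k <= size Q)%N -> (k' <= size Q')%N ->
  add_cell Q k m.+1 = add_cell Q' k' m.+1 -> Q = Q' /\ k = k'.
Proof.
move=> Qm Qm' kQ kQ' cellE; split; first by rewrite -(add_cellK k Qm) cellE add_cellK.
by rewrite -(find_add_cell Qm kQ) cellE find_add_cell.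
Qed.

Lemma RS_rcons w x :
  RS (rcons w x) = ((ins x (RS w).1).1, add_cell (RS w).2 (ins x (RS w).1).2 (size w).+1).
Proof.
have letters v : (foldl (@RS_step n) ([::], [::], 0%N) v).2 = size v.
  elim/last_ind: v => // v y; rewrite -cats1 foldl_cat size_cat addn1 /=.
  by case: (foldl _ _ v) => -[P Q] m /= ->; case: ins.
rewrite /RS -cats1 foldl_cat /=; have := letters w.
by case: (foldl _ _ w) => -[P Q] m /= ->; case: ins.
Qed.

Lemma is_tab_RS w : is_tab (RS w).1.
Proof. by elim/last_ind: w => // w x; rewrite RS_rcons; apply: is_tab_ins. Qed.

Lemma shape_RS w : shape (RS w).1 = shape (RS w).2.
Proof. by elim/last_ind: w => // w x IHw; rewrite RS_rcons; apply: shape_ins. Qed.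

Lemma size_row_word_RS w : size (row_word (RS w).1) = size w.
Proof. by elim/last_ind: w => // w x IHw; rewrite RS_rcons size_row_word_ins IHw size_rcons. Qed.

Lemma entries_le_add_cell Q k m : entries_le m Q -> entries_le m.+1 (add_cell Q k m.+1).
Proof.
have weak p : all (fun e => e <= m)%N p -> all (fun e => e <= m.+1)%N p.
  by apply: sub_all => y /leqW.
elim: Q k => [|r Q IHQ] k /=; first by rewrite /add_cell /entries_le /= leqnn.
case/andP=> /andP[r0 rm] Qm; rewrite add_cell_cons; case: k => [|k] /=.
  rewrite all_rcons leqnn weak // -size_eq0 size_rcons /=.
  by apply: sub_all Qm => s /andP[-> /weak].
by rewrite r0 weak ?IHQ.
Qed.

Lemma entries_le_RS w : entries_le (size w) (RS w).2.
Proof. by elim/last_ind: w => // w x IHw; rewrite RS_rcons size_rcons;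
  apply: entries_le_add_cell. Qed.

Lemma is_tab_sorted_rows T : is_tab T -> sorted_rows T.
Proof. by case/andP. Qed.

Lemma add_cell_RS_inj w u x x' : size w = size u ->
  add_cell (RS w).2 (ins x (RS w).1).2 (size w).+1
    = add_cell (RS u).2 (ins x' (RS u).1).2 (size w).+1 ->
  (RS w).2 = (RS u).2 /\ (ins x (RS w).1).2 = (ins x' (RS u).1).2.
Proof.
have row_le v y : ((ins y (RS v).1).2 <= size (RS v).2)%N.
  by rewrite -(eq_size_shape (shape_RS v)) ins_row_le_size.
by move=> swu; apply: add_cell_inj; rewrite ?entries_le_RS // swu entries_le_RS.
Qed.

Lemma RS_knuth_path w : exists ks, forall u, size u = size w -> (RS u).2 = (RS w).2 ->
  knuth_path ks u (row_word (RS u).1).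
Proof.
elim/last_ind: w => [|w x [ks IHw]]; first by exists [::] => u /size0nil->.
have [ls insP] := ins_knuth_path n (shape (RS w).1) (ins x (RS w).1).2.
exists (ks ++ ls) => u; case/lastP: u => [|u x']; rewrite !size_rcons // => -[suw].
rewrite !RS_rcons /= suw -suw => /add_cell_RS_inj[//|QE kE].
apply: (@knuth_path_trans _ _ _ _ (rcons (row_word (RS u).1) x')).
  by rewrite -!cats1; apply/knuth_path_catr/IHw.
by apply: insP kE; [rewrite !shape_RS QE|apply/is_tab_sorted_rows/is_tab_RS].
Qed.

Lemma separated_RS w u : size w = size u -> (RS w).2 != (RS u).2 -> separated w u.
Proof.
elim/last_ind: w u => [|w x IHw] u; first by move/esym/size0nil->; rewrite eqxx.
case/lastP: u => [|u x']; rewrite !size_rcons // => -[swu].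
case: (eqVneq (RS w).2 (RS u).2) => [QE|/(IHw u swu) Q _]; last first.
  by rewrite -!cats1; apply: separated_catl.
rewrite !RS_rcons /= -swu QE => new_cell.
have [ks pathP] := RS_knuth_path w.
have rpath v y : size v = size w -> (RS v).2 = (RS w).2 ->
    knuth_path ks (rcons v y) (rcons (row_word (RS v).1) y).
  by move=> sv Qv; rewrite -!cats1; apply/knuth_path_catr/pathP.
apply: separated_path (rpath w x erefl erefl) (rpath u x' (esym swu) (esym QE)) _.
apply: separated_ins; rewrite ?shape_RS ?QE ?is_tab_sorted_rows ?is_tab_RS //.
by apply: contraNneq new_cell => ->.
Qed.

End RobinsonSchensted.

(** * Columns of a tableau *)

Section Columns.
Variable n : nat.
Local Notation word := (seq 'I_n).
Local Notation leI := (fun x y : 'I_n => (x <= y)%N).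
Local Notation ltI := (fun x y : 'I_n => (x < y)%N).
Local Notation gtI := (fun x y : 'I_n => (y < x)%N).
Implicit Types (a b x y : 'I_n) (c r s u C : word) (T : tableau n).

Definition drop_column T : tableau n := [seq behead r | r <- T & (1 < size r)%N].

Lemma column_drop_column T k : column (drop_column T) k = column T k.+1.
Proof.
rewrite /column /drop_column; elim: T => //= -[|x r] T IHT //=.
by case: r => [|y r] /=; rewrite IHT //; case: (k).
Qed.

Lemma shape_drop_column T T' : shape T = shape T' -> shape (drop_column T) = shape (drop_column T').
Proof.
elim: T T' => [|r T IHT] [|r' T'] //= [sr /IHT shE].
by rewrite /drop_column /= -sr; case: ifP => //= _; rewrite !size_behead sr; congr (_ :: _).
Qed.

Lemma row_below_trans : transitive (@row_below n).
Proof.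
move=> s r u; elim: r s u => [|a r IHr] [|b s] [|c u] //; rewrite ?row_below0 // !row_below_cons.
by case/andP=> ab rs /andP[bc su]; rewrite (ltn_trans ab bc) (IHr s u).
Qed.

Lemma row_below_behead r s : row_below r s -> row_below (behead r) (behead s).
Proof. by case: r s => [|a r] [|b s] //=; rewrite ?row_below0 // row_below_cons => /andP[]. Qed.

Lemma is_tab_drop_column T : is_tab T -> is_tab (drop_column T).
Proof.
case/andP=> rT ST; apply/andP; split.
  by rewrite all_map all_filter; apply: sub_all rT => -[|x [|y r]] //= /andP[_ ->].
by apply: (homo_sorted row_below_behead); apply: sorted_filter row_below_trans _ _ _.
Qed.

Lemma row_size_le_head T r : is_tab T -> r \in T -> (size r <= size (head [::] T))%N.
Proof.
case/andP=> _; case: T => // r0 T; rewrite /= inE (path_sortedE row_below_trans).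
by case/andP=> /allP rT _ /predU1P[->|/rT /andP[]].
Qed.

Lemma size_head_drop_column T : is_tab T ->
  size (head [::] (drop_column T)) = (size (head [::] T)).-1.
Proof.
move=> tT; have := @row_size_le_head T ^~ tT; rewrite /drop_column; case: T {tT} => //= r T rT.
case: ltnP => [_|r1] /=; first by rewrite size_behead.
rewrite (_ : [seq _ <- T | _] = [::]) /=; first by case: (size r) r1 => [|[]].
apply/eqP; rewrite -(negbK (_ == _)) -has_filter; apply/hasPn=> s sT.
by rewrite -leqNgt (leq_trans (rT s _)) // inE sT orbT.
Qed.

Lemma size_column0 T : is_tab T -> size (column T 0) = size T.
Proof.
by elim: T => // -[|x r] T IHT; rewrite is_tab_cons // => /and4P[_ _ _ /IHT /= <-].
Qed.

Lemma sorted_column0 T : is_tab T -> sorted ltI (column T 0).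
Proof.
elim: T => // -[|x r] T IHT; rewrite is_tab_cons // => /and4P[_ _ xT tT].
have := IHT tT; case: T xT tT {IHT} => // -[|y s] T; first by rewrite is_tab_cons.
by rewrite row_below_cons /column /= => /andP[-> _].
Qed.

Lemma column0_rcons T x r : column (rcons T (x :: r)) 0 = rcons (column T 0) x.
Proof. by rewrite /column; elim: T => //= -[|y s] T /= ->. Qed.

Lemma row_word_drop_column T r :
  row_word (drop_column (rcons T r)) = behead r ++ row_word (drop_column T).
Proof.
rewrite /drop_column filter_rcons; case: ltnP => [_|]; first by rewrite map_rcons row_word_rcons.
by case: r => [|x []].
Qed.

Lemma is_tab_rcons T r : is_tab (rcons T r) -> [/\ is_tab T, r != [::] & sorted leI r].
Proof.
rewrite /is_tab all_rcons -cats1 => /andP[/andP[/andP[r0 Sr] ->]].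
by move=> /cat_sorted2[-> _].
Qed.

Lemma size_row_word_drop_column T : is_tab T ->
  size (row_word T) = (size T + size (row_word (drop_column T)))%N.
Proof.
elim/last_ind: T => // T r IHT /is_tab_rcons[/IHT sT]; case: r => // x r _ _.
by rewrite row_word_drop_column row_word_rcons !size_cat size_rcons sT /=; lia.
Qed.

Lemma letter_column_path x y C : (y <= x)%N -> path gtI y C ->
  knuth_path (iota 0 (size C)) [:: y, x & C] (y :: rcons C x).
Proof.
elim: C y => [|c C IHC] y yx //= /andP[cy cC].
exists [:: y, c, x & C].
  by exists [::], y, x, c, C; rewrite /knuth cy yx (leq_trans cy).
have := knuth_path_catl [:: y] (IHC c (leq_trans (ltnW cy) yx) cC).
by rewrite -iotaDl.
Qed.

Lemma row_column_path k m : exists ks, forall y r C, size r = m -> size C = k ->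
  path leI y r -> path gtI y C -> knuth_path ks (y :: r ++ C) (y :: C ++ r).
Proof.
elim: m => [|m [ks IHm]]; first by exists [::] => y [|? ?] // C _ _ _ _; rewrite cats0.
exists ([seq (1 + i)%N | i <- ks] ++ iota 0 k) => y [|x r] // C [sr] sC /andP[yx xr] yC.
have xC : path gtI x C.
  by case: C yC {sC} => //= c C /andP[cy ->]; rewrite (leq_trans cy yx).
apply: knuth_path_trans (knuth_path_catl [:: y] (IHm x r C sr sC xr xC)) _.
by rewrite -sC; have := knuth_path_catr r (letter_column_path yx yC); rewrite /= cat_rcons.
Qed.

Lemma column_knuth_path sh : exists ks, forall T, shape T = sh -> is_tab T ->
  knuth_path ks (row_word T) (rev (column T 0) ++ row_word (drop_column T)).
Proof.
elim/last_ind: sh => [|sh m [ks IHsh]]; first by exists [::] => -[].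
have [ls passP] := row_column_path (size sh) m.-1.
exists ([seq (m + i)%N | i <- ks] ++ ls) => T; case/lastP: T => [|T r]; first by case: (sh).
rewrite /shape map_rcons => /rcons_inj[sT sr] tT.
have [tT' r0 Sr] := is_tab_rcons tT; case: r r0 Sr sr tT => // x r _ xr sr tT.
rewrite row_word_rcons row_word_drop_column column0_rcons rev_rcons -sr.
apply: knuth_path_trans (knuth_path_catl (x :: r) (IHsh T sT tT')) _.
rewrite !catA; apply: knuth_path_catr; rewrite cat_cons; apply: passP => //.
- by rewrite -sr.
- by rewrite size_rev size_column0 // -sT size_map.
- by have := sorted_column0 tT; rewrite -rev_sorted column0_rcons rev_rcons.
Qed.

Fixpoint add_column c T : tableau n :=
  if c is x :: c' then (x :: head [::] T) :: add_column c' (behead T) else [::].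

Fixpoint column_le c T : bool :=
  match c, T with
  | x :: c', r :: T' => (x <= head x r)%N && column_le c' T'
  | _, _ => nilp T
  end.

Lemma column_le_nil c : column_le c [::].
Proof. by case: c. Qed.

Lemma shape_add_column c c' T T' : size c = size c' -> shape T = shape T' ->
  shape (add_column c T) = shape (add_column c' T').
Proof.
elim: c c' T T' => [|x c IHc] [|x' c'] T T' //= [sc] sh.
rewrite (IHc c' (behead T) (behead T')) //.
  by case: T T' sh => [|r T] [|r' T'] //= [->].
by case: T T' sh => [|r T] [|r' T'] //= [].
Qed.

Lemma sumn_shape_add_column c T : (size T <= size c)%N ->
  sumn (shape (add_column c T)) = (size c + sumn (shape T))%N.
Proof.
by elim: c T => [|x c IHc] [|r T] //=; rewrite ?ltnS => sT; rewrite IHc //=; lia.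
Qed.

Lemma column0_add_column c T : column (add_column c T) 0 = c.
Proof. by rewrite /column; elim: c T => //= x c IHc T; rewrite IHc. Qed.

Lemma drop_add_column c T : is_tab T -> (size T <= size c)%N -> drop_column (add_column c T) = T.
Proof.
rewrite /drop_column; elim: c T => [|x c IHc] [|r T] //=.
  by move=> _ _; have := IHc [::] isT isT.
rewrite is_tab_cons ltnS => /and4P[r0 _ _ tT] sT.
by case: r r0 => //= y r _; rewrite IHc.
Qed.

Lemma is_tab_add_column c T : sorted ltI c -> is_tab T -> column_le c T -> is_tab (add_column c T).
Proof.
elim: c T => [|x c IHc] T //= Sc tT cT.
have tT' : is_tab (behead T) by case: T tT {cT} => //= r T; rewrite is_tab_cons => /and4P[].
have cT' : column_le c (behead T) by case: T cT {tT tT'} => [|r T] /=; [case: (c)|case/andP].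
rewrite is_tab_cons (IHc _ (path_sorted Sc)) //= andbT; apply/andP; split.
  case: T tT cT {tT' cT'} => //= r T; rewrite is_tab_cons => /and4P[r0 Sr _ _] /andP[xr _].
  by case: r r0 Sr xr => //= z r _ -> ->.
case: c Sc {IHc cT cT'} => [|y c] /=; first by rewrite row_below0.
case/andP=> xy _; rewrite row_below_cons xy /=.
by case: T tT {tT'} => //= r T; rewrite is_tab_cons => /and4P[].
Qed.

Lemma column_le_violation x0 c T : is_tab T -> (size T <= size c)%N -> ~~ column_le c T ->
  exists2 r, (r < size T)%N & (nth x0 (column T 0) r < nth x0 c r)%N.
Proof.
elim: c T => [|x c IHc] [|r T] //=; rewrite is_tab_cons ltnS => /and4P[r0 _ _ tT] sT.
rewrite negb_and; case: r r0 => //= y r _.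
rewrite -ltnNge /column /= => /orP[yx|/(IHc T tT sT)[k kT h]]; first by exists 0%N.
by exists k.+1.
Qed.

End Columns.

(** * Inversions and sums over words *)

Section Words.
Variable n : nat.
Local Notation word := (seq 'I_n).
Local Notation ltI := (fun x y : 'I_n => (x < y)%N).
Implicit Types (a b x y : 'I_n) (p r u : word) (Y : {set 'I_n}).

Lemma sorted_enum Y : sorted ltI (enum Y).
Proof.
rewrite /enum_mem -enumT; apply: sorted_filter; first exact: lt_trans.
by have := iota_ltn_sorted 0 n; rewrite -val_enum_ord sorted_map.
Qed.

Lemma enum_sorted u : sorted ltI u -> enum [set x in u] = u.
Proof.
by move=> Su; apply: lt_sorted_eq (sorted_enum _) Su _ => x; rewrite mem_enum inE.
Qed.

Definition n_below Y x : nat := #|[set y in Y | (y < x)%N]|.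

Lemma size_enum_below Y x : size (filter (ltI^~ x) (enum Y)) = n_below Y x.
Proof.
rewrite /n_below cardE; congr size.
by rewrite /enum_mem -filter_predI; apply: eq_filter => y; rewrite /= !inE andbC.
Qed.

Lemma enum_setU1 Y x :
  enum (x |: Y) = filter (ltI^~ x) (enum Y) ++ x :: filter (ltI x) (enum Y).
Proof.
apply: lt_sorted_eq (sorted_enum _) _ _ => [|y]; last first.
  rewrite mem_enum mem_cat in_cons !(mem_filter (ltI _)) !(mem_filter (ltI^~ _)) mem_enum !inE.
  by rewrite -val_eqE /=; case: ltngtP => _; rewrite ?orbT ?orbF.
have below_x : all (ltI^~ x) (filter (ltI^~ x) (enum Y)) by apply: filter_all.
have above_x : all (ltI x) (filter (ltI x) (enum Y)) by apply: filter_all.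
rewrite sorted_pairwise ?pairwise_cat /=; last exact: lt_trans.
rewrite above_x -!(sorted_pairwise lt_trans) !(sorted_filter lt_trans _ (sorted_enum _)).
rewrite !andbT; apply/allrelP=> y z /(allP below_x) yx; rewrite inE => /predU1P[->//|].
by move/(allP above_x); apply: ltn_trans.
Qed.

Lemma enum_below_above Y x : x \notin Y ->
  enum Y = filter (ltI^~ x) (enum Y) ++ filter (ltI x) (enum Y).
Proof.
move=> xY; apply: lt_sorted_eq (sorted_enum _) _ _ => [|y].
  apply: (subseq_sorted lt_trans _ (sorted_enum (x |: Y))); rewrite enum_setU1.
  by rewrite subseq_cat2l subseq_cons.
rewrite mem_enum mem_cat !(mem_filter (ltI _)) !(mem_filter (ltI^~ _)) mem_enum.
by case: (ltngtP y x) => [yx|yx|/val_inj->]; rewrite ?orbF ?(negPf xY).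
Qed.

Fixpoint inversions u : nat :=
  if u is x :: u' then (count (ltI^~ x) u' + inversions u')%N else 0.

Lemma inversions_rcons u x : inversions (rcons u x) = (inversions u + count (ltI x) u)%N.
Proof.
by elim: u => //= y u ->; rewrite -cats1 count_cat /= addn0; lia.
Qed.

Lemma inversions_rev u : uniq u -> (inversions u + inversions (rev u))%N = 'C(size u, 2).
Proof.
elim: u => //= x u IHu /andP[xu Uu]; rewrite rev_cons inversions_rcons count_rev binS bin1 -IHu //.
have -> : size u = (count (ltI^~ x) u + count (ltI x) u)%N; last by lia.
rewrite -[LHS](count_predC (ltI^~ x)); congr (_ + _)%N; apply: eq_in_count => y yu /=.
by case: (ltngtP y x) => // /val_inj yx; rewrite -yx yu in xu.
Qed.

Lemma inversions_eq0 u : uniq u -> (inversions u == 0%N) = sorted ltI u.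
Proof.
rewrite sorted_pairwise; last exact: lt_trans.
elim: u => //= x u IHu /andP[xu /IHu <-]; rewrite addn_eq0; congr (_ && _).
rewrite -leqn0 leqNgt -has_count -all_predC; apply: eq_in_all => y yu /=.
by rewrite -leqNgt leq_eqVlt; case: eqP => // /val_inj yx; rewrite yx yu in xu.
Qed.

Lemma perm_swap a b p r : perm_eq (p ++ [:: b, a & r]) (p ++ [:: a, b & r]).
Proof. by rewrite perm_cat2l -cat1s -(cat1s a) perm_catCA. Qed.

Lemma inversions_swap p a b r : (a < b)%N ->
  inversions (p ++ [:: b, a & r]) = (inversions (p ++ [:: a, b & r])).+1.
Proof.
move=> ab; elim: p => [|x p /= ->].
  by rewrite /= ab ltnNge (ltnW ab); lia.
by rewrite (seq.permP (perm_swap a b p r)) addnS.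
Qed.

Section Sums.
Variable V : nmodType.
Implicit Type F : word -> V.

Lemma sum_tuple0 F : \sum_(u : 0.-tuple 'I_n) F u = F [::].
Proof. by rewrite (big_pred1 [tuple]) // => u; rewrite [u]tuple0 /= eqxx. Qed.

Lemma sum_tupleS m F :
  \sum_(u : m.+1.-tuple 'I_n) F u = \sum_x \sum_(u : m.-tuple 'I_n) F (x :: u).
Proof.
rewrite pair_big /=.
rewrite (reindex (fun xu : 'I_n * m.-tuple 'I_n => [tuple of xu.1 :: xu.2])) //=.
exists (fun u : m.+1.-tuple 'I_n => (thead u, [tuple of behead u])) => [[x u] _|u _] /=.
  by congr (_, _); apply: val_inj.
by rewrite -tuple_eta.
Qed.

Lemma sum_tuple1 F : \sum_(u : 1.-tuple 'I_n) F u = \sum_x F [:: x].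
Proof.
by rewrite sum_tupleS; apply: eq_bigr => x _; rewrite (sum_tuple0 (fun u => F (x :: u))).
Qed.

Lemma sum_tupleD m1 m2 F : \sum_(u : (m1 + m2).-tuple 'I_n) F u
  = \sum_(u1 : m1.-tuple 'I_n) \sum_(u2 : m2.-tuple 'I_n) F (u1 ++ u2).
Proof.
elim: m1 F => [|m1 IHm] F.
  by rewrite (sum_tuple0 (fun u1 => \sum_(u2 : m2.-tuple 'I_n) F (u1 ++ u2))).
rewrite addSn sum_tupleS (sum_tupleS _ (fun u1 => \sum_(u2 : m2.-tuple 'I_n) F (u1 ++ u2))).
by apply: eq_bigr => x _; rewrite (IHm (fun u => F (x :: u))).
Qed.

Lemma sum_tuple_swap_at m i F :
  \sum_(u : m.-tuple 'I_n) F (swap_at i u) = \sum_(u : m.-tuple 'I_n) F u.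
Proof.
have size_swap (u : m.-tuple 'I_n) : size (swap_at i u) == m by rewrite size_swap_at size_tuple.
rewrite [RHS](reindex_inj (h := fun u : m.-tuple _ => Tuple (size_swap u))) // => u v [].
by move/(inv_inj (@swap_atK n i))/val_inj.
Qed.

End Sums.
End Words.

(** * q-alternating functions *)

Section Alternating.
Variables (K : fieldType) (n : nat).
Local Notation q := (qv K).
Local Notation sgn := ((- qv K)^-1).
Local Notation word := (seq 'I_n).
Local Notation ltI := (fun x y : 'I_n => (x < y)%N).
Implicit Types (a b x y : 'I_n) (p r u w : word) (X Y : {set 'I_n}).

Lemma add_qv_inv_neq0 : q + q^-1 != 0.
Proof.
apply/negP=> /eqP/(congr1 ( *%R q)); rewrite mulrDr divff ?qv_neq0 // mulr0.
rewrite -tofracM -tofrac1 -tofracD => /eqP; rewrite tofrac_eq0 => /eqP.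
move/(congr1 (fun p : {poly K} => p`_0)) => /eqP.
by rewrite coefD coefXM coef1 coef0 add0r oner_eq0.
Qed.

Lemma sgnE : sgn = - q^-1.
Proof. by rewrite invrN. Qed.

Lemma sgn_quadratic : 1 + (q - q^-1) * sgn = sgn * sgn.
Proof. by rewrite sgnE mulrNN mulrN mulrBl divff ?qv_neq0 // opprB addrC subrK. Qed.

Lemma laurent_sgnX m : laurent_scalar (sgn ^+ m).
Proof.
have lR := laurent_scalar_subring K.
by apply: (subringX lR); rewrite sgnE; apply/(subringN lR)/laurent_scalar_qV.
Qed.

Section Functions.
Variable V : lmodType (Kq K).
Implicit Type F : word -> V.

Definition q_alternating m F :=
  forall i w, (i.+1 < m)%N -> size w = m -> hecke i F w = sgn *: F w.

Lemma hecke_cat F i p w : hecke (size p + i) F (p ++ w) = hecke i (fun u => F (p ++ u)) w.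
Proof. by rewrite /hecke swap_at_cat adjacent_cat. Qed.

Lemma hecke_catl F i w r : (i.+1 < size w)%N ->
  hecke i F (w ++ r) = hecke i (fun u => F (u ++ r)) w.
Proof. by move=> iw; rewrite /hecke swap_at_catl // adjacent_catl. Qed.

Lemma hecke_window F p a b r : hecke (size p) F (p ++ [:: a, b & r])
  = F (p ++ [:: b, a & r]) + hecke_coef K a b *: F (p ++ [:: a, b & r]).
Proof. by rewrite -[size p]addn0 hecke_cat. Qed.

Lemma q_alternatingP m F : q_alternating m F <-> forall p a b r, size (p ++ [:: a, b & r]) = m ->
  ((a < b)%N -> F (p ++ [:: b, a & r]) = sgn *: F (p ++ [:: a, b & r])) /\
  F (p ++ [:: a, a & r]) = 0.
Proof.
split=> [Falt p a b r sm|Falt i w im sw].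
  have window c d : hecke (size p) F (p ++ [:: c, d & r]) = sgn *: F (p ++ [:: c, d & r]).
    by apply: Falt; rewrite -sm !size_cat //= !addnS !ltnS leq_addr.
  split=> [ab|]; first by rewrite -window hecke_window hecke_coef_lt // scale0r addr0.
  have /eqP := window a a; rewrite hecke_window hecke_coef_eq scalerBl scale1r addrC subrK.
  by rewrite sgnE -subr_eq0 -scalerBl opprK scaler_eq0 (negPf add_qv_inv_neq0) => /eqP.
have [p [a [b [r [wE <-]]]]] : exists p a b r, w = p ++ [:: a, b & r] /\ size p = i.
  by apply: adjacent_split; rewrite sw.
rewrite {}wE in sw *; rewrite hecke_window; have [Fab Faa] := Falt p a b r sw.
case: (ltngtP a b) => [ab|ba|/val_inj ab].
- by rewrite Fab // hecke_coef_lt // scale0r addr0.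
- have [|/(_ ba) -> _] := Falt p b a r; first by rewrite -sw !size_cat.
  rewrite hecke_coef_gt // !scalerA -[X in X + _]scale1r -scalerDl; congr (_ *: _).
  exact: sgn_quadratic.
- by rewrite -ab Faa !scaler0 addr0.
Qed.

Lemma q_alternating_catl m F p :
  q_alternating (size p + m) F -> q_alternating m (fun u => F (p ++ u)).
Proof.
by move=> Falt i w im sw; rewrite -hecke_cat Falt ?size_cat ?sw // -addnS ltn_add2l.
Qed.

Lemma q_alternating_catr m F r :
  q_alternating (m + size r) F -> q_alternating m (fun u => F (u ++ r)).
Proof.
move=> Falt i w im sw; rewrite -hecke_catl ?sw // Falt ?size_cat ?sw //.
by rewrite ltn_addr.
Qed.

Lemma q_alternating_move F p x u r : q_alternating (size (p ++ x :: u ++ r)) F ->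
  all (ltI^~ x) u -> F (p ++ x :: u ++ r) = sgn ^+ size u *: F (p ++ u ++ x :: r).
Proof.
elim: u p => [|y u IHu] p Falt; first by rewrite scale1r.
case/andP=> yx ux; have /q_alternatingP/(_ p y x (u ++ r)) [] := Falt.
  by rewrite !size_cat.
move=> /(_ yx) -> _; rewrite -cat_rcons IHu //; last by rewrite cat_rcons /= !size_cat in Falt *.
by rewrite scalerA -exprS cat_rcons.
Qed.

Lemma q_alternating_sort F p u : q_alternating (size (p ++ u)) F ->
  F (p ++ u) = if uniq u then sgn ^+ inversions u *: F (p ++ enum [set x in u]) else 0.
Proof.
elim: u p => [|x u IHu] p Falt; first by rewrite (enum_sorted (u := [::])) // scale1r.
rewrite -cat_rcons IHu ?cat_rcons //=; case: ifP => Uu; last by rewrite andbF.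
pose S := [set y in u]; pose L := filter (ltI^~ x) (enum S); pose R := filter (ltI x) (enum S).
have mem_S : enum S =i u by move=> y; rewrite mem_enum inE.
have size_L : size L = count (ltI^~ x) u.
  by rewrite size_filter; apply/seq.permP/uniq_perm; rewrite ?enum_uniq.
have alt r : size r = size u -> q_alternating (size (p ++ x :: r)) F.
  by move=> sr; rewrite size_cat /= sr -/(size (x :: u)) -size_cat.
have size_S : size (enum S) = size u by rewrite -(perm_size (uniq_perm (enum_uniq _) Uu mem_S)).
rewrite andbT; case: ifPn => xu.
  have enum_xS : enum (x |: S) = L ++ x :: R := enum_setU1 S x.
  have enum_S : enum S = L ++ R by apply: enum_below_above; rewrite inE.
  rewrite -/S enum_S q_alternating_move -?enum_S; [|exact: alt|exact: filter_all].
  rewrite scalerA -exprD addnC size_L -enum_xS; congr (_ *: F (_ ++ enum (pred_of_set _))).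
  by apply/setP=> y; rewrite !inE.
have enum_S : enum S = L ++ x :: R.
  rewrite -enum_setU1; congr (enum (pred_of_set _)); apply/esym/setUidPr.
  by rewrite sub1set inE negbK in xu *.
have LRalt : q_alternating (size (p ++ L ++ [:: x, x & R])) F.
  by have := alt _ size_S; rewrite enum_S !size_cat /= !size_cat /= !addnS.
rewrite -/S enum_S q_alternating_move; last exact: filter_all; last by rewrite -enum_S; exact: alt.
by have := (q_alternatingP _ _).1 LRalt (p ++ L) x x R; rewrite -catA => -[] // _ ->;
  rewrite !scaler0.
Qed.

End Functions.

Definition arrangement Y u := uniq u && ([set x in u] == Y).

Lemma card_arrangement Y u : arrangement Y u -> #|Y| = size u.
Proof. by case/andP=> Uu /eqP<-; rewrite cardsE; apply/card_uniqP. Qed.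

Lemma arrangement_enum Y : arrangement Y (enum Y).
Proof. by rewrite /arrangement enum_uniq; apply/eqP/setP=> x; rewrite inE mem_enum. Qed.

(* Coefficients of the q-antisymmetric tensor with support Y. *)
Definition ext_coef u Y : Kq K := if arrangement Y u then sgn ^+ inversions u else 0.

Lemma laurent_ext_coef u Y : laurent_scalar (ext_coef u Y).
Proof.
rewrite /ext_coef; case: ifP => _; first exact: laurent_sgnX.
exact: subring0 (laurent_scalar_subring K).
Qed.

Lemma ext_coef_size u Y : size u != #|Y| -> ext_coef u Y = 0.
Proof.
by rewrite /ext_coef; case: ifP => // /card_arrangement->; rewrite eqxx.
Qed.

Lemma ext_coef_cons x u Y :
  ext_coef (x :: u) Y = if x \in Y then sgn ^+ n_below Y x * ext_coef u (Y :\ x) else 0.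
Proof.
rewrite /ext_coef /arrangement /=; case: (boolP (x \in Y)) => xY; last first.
  by case: ifP => // /andP[_ /eqP YE]; rewrite -YE inE mem_head in xY.
have -> : (x \notin u) && uniq u && ([set y in x :: u] == Y)
    = uniq u && ([set y in u] == Y :\ x).
  rewrite andbAC andbC; congr (_ && _); apply/andP/eqP => [[xu /eqP<-]|YE].
    by apply/setP=> y; rewrite !inE; case: eqP => //= ->; rewrite (negPf xu).
  have xu : x \notin u by have := setD11 x Y; rewrite -YE inE => ->.
  by split=> //; apply/eqP; rewrite -(setD1K xY) -YE; apply/setP=> y; rewrite !inE.
case: ifP => [/andP[Uu /eqP YE]|_]; last by rewrite mulr0.
rewrite exprD; congr (sgn ^+ _ * _).
rewrite -size_filter -(card_uniqP (filter_uniq _ Uu)); apply: eq_card => y.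
rewrite mem_filter inE andbC -[y \in u]in_set -/(y \in [set _ in _]) YE !inE.
by case: eqP => // ->; rewrite ltnn !andbF.
Qed.

Lemma ext_coef_alternating m Y : q_alternating m (fun u => ext_coef u Y : (Kq K)^o).
Proof.
apply/q_alternatingP=> p a b r _; split=> [ab|]; last first.
  by rewrite /ext_coef /arrangement cat_uniq /= mem_head !andbF.
have ba := perm_swap a b p r.
have set_ba : [set x in p ++ [:: b, a & r]] = [set x in p ++ [:: a, b & r]].
  by apply/setP=> x; rewrite !inE (perm_mem ba).
rewrite /ext_coef /arrangement (perm_uniq ba) set_ba.
by case: ifP => _; rewrite ?scaler0 // inversions_swap // exprS.
Qed.

Lemma q_alternatingE (V : lmodType (Kq K)) (F : word -> V) u :
  q_alternating (size u) F -> F u = \sum_(Y : {set 'I_n}) ext_coef u Y *: F (enum Y).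
Proof.
move=> /(@q_alternating_sort _ F [::] u) /= ->; rewrite /ext_coef /arrangement.
case: ifP => Uu /=; last by rewrite big1 // => Y _; rewrite scale0r.
rewrite (bigD1 [set x in u]) //= eqxx big1 ?addr0 // => Y /negPf.
by rewrite eq_sym => ->; rewrite scale0r.
Qed.

Lemma ext_coef_cat u1 u2 Y : ext_coef (u1 ++ u2) Y =
  \sum_(Y1 : {set 'I_n}) \sum_(Y2 : {set 'I_n})
    ext_coef (enum Y1 ++ enum Y2) Y * (ext_coef u1 Y1 * ext_coef u2 Y2).
Proof.
have alt m := @ext_coef_alternating m Y.
rewrite (@q_alternatingE _ (fun u => ext_coef (u ++ u2) Y : (Kq K)^o) u1); last first.
  exact: q_alternating_catr (alt _).
apply: eq_bigr => Y1 _.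
rewrite (@q_alternatingE _ (fun u => ext_coef (enum Y1 ++ u) Y : (Kq K)^o) u2); last first.
  exact: q_alternating_catl (alt _).
by rewrite scaler_sumr; apply: eq_bigr => Y2 _; rewrite mulrC -mulrA.
Qed.

End Alternating.

Arguments ext_coef {K n} u Y.

(** * Quantum minors *)

Section Minors.
Variables (K : fieldType) (n : nat).
Local Notation q := (qv K).
Local Notation sgn := ((- qv K)^-1).
Local Notation word := (seq 'I_n).
Implicit Types (x : 'I_n) (u v w : word) (X Y Z : {set 'I_n}).

Section Model.
Variables (A : algType (Kq K)) (t : 'I_n -> 'I_n -> A).

Definition mon_sum w (V : word -> A) : A :=
  \sum_(u : (size w).-tuple 'I_n) qmonomial t w u * V u.

Definition minor w Y : A :=
  \sum_(u : (size w).-tuple 'I_n) ext_coef u Y *: qmonomial t w u.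

Lemma minor_sum m w Y : size w = m ->
  minor w Y = \sum_(u : m.-tuple 'I_n) ext_coef u Y *: qmonomial t w u.
Proof. by move=> <-. Qed.

Lemma minorE w Y : minor w Y = mon_sum w (fun u => (ext_coef u Y)%:A).
Proof. by apply: eq_bigr => u _; rewrite mulr_algr. Qed.

Lemma minor_size w Y : size w != #|Y| -> minor w Y = 0.
Proof. by move=> sY; apply: big1 => u _; rewrite ext_coef_size ?scale0r ?size_tuple. Qed.

Lemma minor_cat w1 w2 Y : minor (w1 ++ w2) Y =
  \sum_(J : {set 'I_n} * {set 'I_n})
    ext_coef (enum J.1 ++ enum J.2) Y *: (minor w1 J.1 * minor w2 J.2).
Proof.
rewrite /minor size_cat (sum_tupleD _ _ (fun u => ext_coef u Y *: qmonomial t (w1 ++ w2) u)).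
transitivity (\sum_(u1 : (size w1).-tuple 'I_n) \sum_(u2 : (size w2).-tuple 'I_n)
  \sum_(J : {set 'I_n} * {set 'I_n}) ext_coef (enum J.1 ++ enum J.2) Y *:
    ((ext_coef u1 J.1 *: qmonomial t w1 u1) * (ext_coef u2 J.2 *: qmonomial t w2 u2))).
  apply: eq_bigr => u1 _; apply: eq_bigr => u2 _.
  rewrite qmonomial_cat ?size_tuple // ext_coef_cat pair_big scaler_suml.
  by apply: eq_bigr => J _; rewrite -scalerAl -scalerAr !scalerA mulrA.
under eq_bigr => u1 _ do rewrite exchange_big.
rewrite exchange_big; apply: eq_bigr => J _.
rewrite mulr_suml scaler_sumr; apply: eq_bigr => u1 _.
by rewrite mulr_sumr scaler_sumr.
Qed.

Hypothesis rt : qmat_rel t.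

Lemma hecke_mon_sum i w V : hecke i (mon_sum ^~ V) w = mon_sum w (hecke i V).
Proof.
rewrite /hecke /mon_sum size_swap_at; under [RHS]eq_bigr => u _ do rewrite mulrDr.
rewrite scaler_sumr -big_split [RHS]big_split /=.
rewrite -(sum_tuple_swap_at _ i (fun u => qmonomial t w u * V (swap_at i u))) -big_split.
apply: eq_bigr => u _ /=.
rewrite swap_atK -scalerAr scalerAl -mulrDl scalerAl -mulrDl; congr (_ * _).
by apply: (hecke_qmonomial rt); rewrite size_tuple.
Qed.

Lemma minor_alternating m Y : q_alternating m (minor^~ Y).
Proof.
move=> i w im sw.
transitivity (mon_sum w (hecke i (fun u => (ext_coef u Y)%:A))).
  by rewrite -hecke_mon_sum; apply: eq_hecke => u _; apply: minorE.
rewrite minorE /mon_sum scaler_sumr; apply: eq_bigr => u _; rewrite scalerAr; congr (_ * _).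
rewrite scalerA -[sgn * _](@ext_coef_alternating K n m Y i u) ?size_tuple //.
exact: hecke_in_alg.
Qed.

Lemma minor_sort w Y : minor w Y = \sum_(X : {set 'I_n}) ext_coef w X *: minor (enum X) Y.
Proof. exact: (q_alternatingE (@minor_alternating (size w) Y)). Qed.

End Model.

Definition transpose_gen (A : Type) (t : 'I_n -> 'I_n -> A) := fun i j => t j i.

Lemma qmat_rel_transpose (A : algType (Kq K)) (t : 'I_n -> 'I_n -> A) :
  qmat_rel t -> qmat_rel (transpose_gen t).
Proof.
case=> r1 r2 r3 r4; rewrite /transpose_gen; split=> [i k l kl|i j k ij|i j k l ij kl|i j k l ij kl].
- exact: r2.
- exact: r1.
- by rewrite (r3 k l i j).
- by rewrite (r4 k l i j) // (r3 k l i j).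
Qed.

Lemma qmonomial_transpose (A : algType (Kq K)) (t : 'I_n -> 'I_n -> A) w u :
  qmonomial (transpose_gen t) w u = qmonomial t u w.
Proof.
elim: w u => [|i w IHw] [|j u]; rewrite /qmonomial ?big_nil //=.
by rewrite !big_cons; congr (_ * _); apply: IHw.
Qed.

Lemma n_below_nth X x0 i : (i < #|X|)%N -> n_below X (nth x0 (enum X) i) = i.
Proof.
rewrite cardE => iX; rewrite -size_enum_below.
by rewrite (filter_lt_nth (T := 'I_n)) ?size_takel ?(ltnW iX) //; apply: sorted_enum.
Qed.

Lemma sum_n_below X (f : nat -> Kq K) : \sum_(x in X) f (n_below X x) = \sum_(i < #|X|) f i.
Proof.
rewrite -big_enum; case sX: (enum X) => [|x0 r].
  by rewrite cardE sX big_nil big_ord0.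
rewrite -sX (big_nth x0) -cardE big_mkord; apply: eq_bigr => i _.
by rewrite n_below_nth.
Qed.

Definition ext_norm X : Kq K := \sum_(v : #|X|.-tuple 'I_n) ext_coef v X ^+ 2.

Lemma ext_normE X : ext_norm X = \prod_(k < #|X|) \sum_(i < k.+1) (sgn ^+ 2) ^+ i.
Proof.
move sX: #|X| => m; elim: m X sX => [|m IHm] X sX.
  rewrite /ext_norm sX (sum_tuple0 (fun v => ext_coef v X ^+ 2)) big_ord0.
  have -> : X = set0 by apply/eqP; rewrite -cards_eq0 sX.
  by rewrite /ext_coef /arrangement /= (_ : [set x in [::]] = set0) ?eqxx ?expr1n //;
    apply/setP=> x; rewrite !inE.
rewrite big_ord_recr /= -sX -(sum_n_below X) mulr_sumr.
rewrite /ext_norm sX (sum_tupleS _ (fun v => ext_coef v X ^+ 2)) [RHS]big_mkcond.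
apply: eq_bigr => x _; case: ifP => xX; last first.
  by rewrite big1 // => v _; rewrite ext_coef_cons xX expr0n.
have sX1 : #|X :\ x| = m by move: sX; rewrite (cardsD1 x) xX => -[].
rewrite -(IHm _ sX1) /ext_norm sX1 mulr_suml; apply: eq_bigr => v _.
by rewrite ext_coef_cons xX exprMn -!exprM [(2 * _)%N]mulnC mulrC.
Qed.

Lemma ext_norm_neq0 X : ext_norm X != 0.
Proof.
rewrite ext_normE; apply/prodf_neq0 => k _; apply/eqP=> sum0.
have := subrX1 (sgn ^+ 2) k.+1; rewrite sum0 mulr0 => /eqP; rewrite subr_eq0 -exprM => /eqP.
move/(congr1 ( *%R ((- q) ^+ (2 * k.+1)))); rewrite -exprMn divff ?oppr_eq0 ?qv_neq0 //.
rewrite expr1n mulr1 exprM sqrrN -exprM => /eqP.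
rewrite eq_sym -tofrac1 -tofracXn -subr_eq0 -tofracB tofrac_eq0 => /eqP XE.
by have := size_Xn_sub_1 K (n := 2 * k.+1) isT; rewrite XE size_poly0.
Qed.

(* Both minors are, up to the same nonzero factor, the doubly antisymmetrized sum of the
   monomials with row set X and column set Y. *)
Lemma minor_transpose (A : algType (Kq K)) (t : 'I_n -> 'I_n -> A) X Y : qmat_rel t ->
  minor t (enum X) Y = minor (transpose_gen t) (enum Y) X.
Proof.
move=> rt; case: (eqVneq #|X| #|Y|) => sXY; last first.
  by rewrite !minor_size // -cardE // eq_sym.
have antisym (t' : 'I_n -> 'I_n -> A) Z Z' : qmat_rel t' ->
    ext_norm Z *: minor t' (enum Z) Z' = \sum_(v : #|Z|.-tuple 'I_n) ext_coef v Z *: minor t' v Z'.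
  move=> rt'; rewrite scaler_suml; apply: eq_bigr => v _.
  rewrite (minor_sort rt' v) [RHS]scaler_sumr (bigD1 Z) //= scalerA -expr2 big1 ?addr0 // => Z1 ZZ1.
  rewrite scalerA /ext_coef /arrangement; case: ifP => [/andP[_ /eqP->]|_];
    last by rewrite mul0r scale0r.
  by rewrite eq_sym (negPf ZZ1) andbF mulr0 scale0r.
apply: (scalerI (ext_norm_neq0 X)); rewrite antisym //.
have -> : ext_norm X = ext_norm Y by rewrite !ext_normE sXY.
rewrite antisym; last exact: qmat_rel_transpose.
under eq_bigr => v _ do rewrite (minor_sum _ _ (size_tuple v)) scaler_sumr.
under [RHS]eq_bigr => u _ do rewrite (minor_sum _ _ (size_tuple u)) scaler_sumr.
rewrite sXY exchange_big; apply: eq_bigr => u _; apply: eq_bigr => v _ /=.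
by rewrite qmonomial_transpose !scalerA mulrC.
Qed.

End Minors.

(** * The braiding *)

Section Braiding.
Variables (K : fieldType) (n : nat).
Local Notation q := (qv K).
Local Notation word := (seq 'I_n).
Implicit Types (a b c x y : 'I_n) (p r u v w : word).

Section HeckeRelations.
Variable V : lmodType (Kq K).
Implicit Type F : word -> V.

Lemma adjacent_swap_far T (f : 'I_n -> 'I_n -> T) d i j w : (i.+1 < j)%N ->
  adjacent f d i (swap_at j w) = adjacent f d i w /\
  adjacent f d j (swap_at i w) = adjacent f d j w.
Proof.
elim: i j w => [|i IHi] [|[|j]] [|a w] //=; rewrite ?adjacent_cons.
  by case: w => [|b w].
by rewrite !ltnS => ij; apply: (IHi j.+1).
Qed.

Lemma swap_at_far i j w : (i.+1 < j)%N ->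
  swap_at i (swap_at j w) = swap_at j (swap_at i w).
Proof.
elim: i j w => [|i IHi] [|[|j]] [|a w] //=; first by case: w.
by rewrite !ltnS => ij; congr (_ :: _); apply: (IHi j.+1).
Qed.

Lemma hecke_far i j F w : (i.+1 < j)%N ->
  hecke i (hecke j F) w = hecke j (hecke i F) w.
Proof.
move=> ij; rewrite /hecke (swap_at_far w ij) !scalerDr !scalerA.
have [-> ->] := adjacent_swap_far (@hecke_coef K n) 0 w ij.
by rewrite addrACA; congr (_ + (_ + _ *: _)); apply: mulrC.
Qed.

End HeckeRelations.

Lemma hecke_braid3 (F : word -> (Kq K)^o) a b c r :
  hecke 0 (hecke 1 (hecke 0 F)) [:: a, b, c & r]
  = hecke 1 (hecke 0 (hecke 1 F)) [:: a, b, c & r].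
Proof.
rewrite /hecke /adjacent /= /GRing.scale /=.
pose f x y z : Kq K := F [:: x, y, z & r]; rewrite -!/(f _ _ _).
have q0 := qv_neq0 K; have lt := @hecke_coef_lt K n.
have eq := @hecke_coef_eq K n; have gt := @hecke_coef_gt K n.
move: {F} f => f; move: (hecke_coef K (n:=n)) lt eq gt => co.
move: q q0 => z /divff zV lt eq gt.
case: (ltngtP a b) => [ab|ba|/val_inj <-].
- case: (ltngtP b c) => [bc|cb|/val_inj <-].
  + by rewrite (lt _ _ ab) (lt _ _ bc) (lt _ _ (ltn_trans ab bc)); ring.
  + rewrite (lt _ _ ab) (gt _ _ ab) (lt _ _ cb) (gt _ _ cb).
    by case: (ltngtP a c) => [ac|ca|/val_inj <-]; rewrite ?(lt _ _ ac) ?(gt _ _ ca) ?eq; ring.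
  + by rewrite (lt _ _ ab) (gt _ _ ab) eq; ring.
- case: (ltngtP b c) => [bc|cb|/val_inj <-].
  + rewrite (lt _ _ ba) (gt _ _ ba) (lt _ _ bc) (gt _ _ bc).
    by case: (ltngtP a c) => [ac|ca|/val_inj <-]; rewrite ?(lt _ _ ac) ?(gt _ _ ca) ?eq; ring.
  + by rewrite (lt _ _ ba) (gt _ _ ba) (lt _ _ cb) (gt _ _ cb) (gt _ _ (ltn_trans cb ba)); ring.
  + by rewrite (lt _ _ ba) (gt _ _ ba) eq; ring: zV.
- case: (ltngtP a c) => [ac|ca|/val_inj <-]; rewrite eq.
  + by rewrite (lt _ _ ac); ring.
  + by rewrite (gt _ _ ca) (lt _ _ ca); ring: zV.
  + by ring.
Qed.

Lemma hecke_braid i (F : word -> (Kq K)^o) w : (i.+2 < size w)%N ->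
  hecke i (hecke i.+1 (hecke i F)) w = hecke i.+1 (hecke i (hecke i.+1 F)) w.
Proof.
move=> iw; have [p [a [b [c [r [-> <-]]]]]] :
    exists p a b c r, w = p ++ [:: a, b, c & r] /\ size p = i.
  exists (take i w); case wE: (drop i w) (size_drop i w) => [|a [|b [|c r]]] /= sd; try lia.
  by exists a, b, c, r; rewrite -wE cat_take_drop size_takel //; lia.
have := hecke_braid3 (fun u => F (p ++ u)) a b c r.
have swap0 u := swap_at_cat 0 p u; have swap1 u := swap_at_cat 1 p u.
have coef0 u := adjacent_cat (@hecke_coef K n) 0 0 p u.
have coef1 u := adjacent_cat (@hecke_coef K n) 0 1 p u.
rewrite addn0 addn1 in swap0 swap1 coef0 coef1 *.
by rewrite /hecke !(swap0, swap1, coef0, coef1).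
Qed.

(* The product T_m ... T_1, which moves the first letter past the next m letters. *)
Fixpoint hecke_cycle (V : lmodType (Kq K)) m (F : word -> V) : word -> V :=
  if m is m'.+1 then hecke m' (hecke_cycle m' F) else F.

Section HeckeCycle.
Variable V : lmodType (Kq K).
Implicit Type F : word -> V.

Lemma eq_hecke_cycle m F G w :
  (forall v, size v = size w -> F v = G v) -> hecke_cycle m F w = hecke_cycle m G w.
Proof.
elim: m w => [|m IHm] w FG /=; first exact: FG.
by apply: eq_hecke => v sv; apply: IHm => u su; apply: FG; rewrite su.
Qed.

Lemma hecke_cycleZ m (e : Kq K) F w :
  hecke_cycle m (fun u => e *: F u) w = e *: hecke_cycle m F w.
Proof.
elim: m w => //= m IHm w; rewrite /hecke !IHm scalerDr !scalerA.
by congr (_ + _ *: _); apply: mulrC.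
Qed.

Lemma hecke_far_cycle i m F w : (m < i)%N ->
  hecke i (hecke_cycle m F) w = hecke_cycle m (hecke i F) w.
Proof.
elim: m w => //= m IHm w mi; rewrite -hecke_far //.
by apply: eq_hecke => v _; apply: IHm; apply: ltnW.
Qed.

End HeckeCycle.

Lemma hecke_cycle_in_alg (A : lalgType (Kq K)) m (F : word -> (Kq K)^o) w :
  hecke_cycle m (fun u => (F u : Kq K)%:A : A) w = (hecke_cycle m F w : Kq K)%:A.
Proof.
elim: m w => //= m IHm w; rewrite -hecke_in_alg.
by apply: eq_hecke => v _; apply: IHm.
Qed.

(* The braid relation turns antisymmetry in the last m letters into antisymmetry in the first m. *)
Lemma hecke_hecke_cycle i m (F : word -> (Kq K)^o) w : (i.+1 < m)%N -> (m < size w)%N ->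
  hecke i (hecke_cycle m F) w = hecke_cycle m (hecke i.+1 F) w.
Proof.
elim: m w => // m IHm w im mw /=; move: im; rewrite ltnS leq_eqVlt => /orP[/eqP im|im].
  rewrite -im /= hecke_braid ?im //; apply: eq_hecke => v sv /=.
  by apply: eq_hecke => u _; apply: hecke_far_cycle; rewrite -im.
rewrite hecke_far //; apply: eq_hecke => v sv.
by apply: IHm; rewrite // sv ltnW.
Qed.

Lemma laurent_hecke_coef i u : laurent_scalar (adjacent (@hecke_coef K n) 0 i u).
Proof.
have lR := laurent_scalar_subring K.
rewrite /adjacent; case: drop => [|a [|b v]]; try exact: subring0 lR.
rewrite /hecke_coef; case: ifP => _; first exact: subring0 lR.
case: ifP => _; apply: (subringB lR); try exact: laurent_scalar_q.
  exact: subring1 lR.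
exact: laurent_scalar_qV.
Qed.

Lemma laurent_hecke_cycle m (F : word -> (Kq K)^o) w :
  (forall u, laurent_scalar (F u : Kq K)) -> laurent_scalar (hecke_cycle m F w : Kq K).
Proof.
have lR := laurent_scalar_subring K; move=> FL.
elim: m w => //= m IHm w; apply: (subringD lR); first exact: IHm.
by apply: (subringM lR); [exact: laurent_hecke_coef|exact: IHm].
Qed.

Lemma hecke_cycle_mon_sum (A : algType (Kq K)) (t : 'I_n -> 'I_n -> A) m w (V : word -> A) :
  qmat_rel t -> hecke_cycle m (mon_sum t ^~ V) w = mon_sum t w (hecke_cycle m V).
Proof.
move=> rt; elim: m w => //= m IHm w; rewrite -hecke_mon_sum //.
by apply: eq_hecke => v _; apply: IHm.
Qed.

(* The quadratic relation gives T^-1 = T - (q - q^-1). *)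
Lemma hecke_inv (V : lmodType (Kq K)) i (F : word -> V) w : (i.+1 < size w)%N ->
  F w = hecke i F (swap_at i w)
        + (adjacent (@hecke_coef K n) 0 i w - (q - q^-1)) *: hecke i F w.
Proof.
move=> /adjacent_split[p [a [b [r [-> <-]]]]].
have swap0 u := swap_at_cat 0 p u; have coef0 u := adjacent_cat (@hecke_coef K n) 0 0 p u.
rewrite addn0 in swap0 coef0; rewrite /hecke !(swap0, coef0) /adjacent /=.
case: (ltngtP a b) => [ab|ba|/val_inj <-].
- by rewrite (hecke_coef_lt _ ab) (hecke_coef_gt _ ab) scale0r addr0 sub0r scaleNr addrK.
- by rewrite (hecke_coef_lt _ ba) (hecke_coef_gt _ ba) subrr !scale0r !addr0.
set x := F _; rewrite hecke_coef_eq.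
have -> : x + (q - 1) *: x = q *: x by rewrite scalerBl scale1r addrC subrK.
have qV := divff (qv_neq0 K); rewrite scalerA -scalerDl -[LHS]scale1r; congr (_ *: _).
by ring: qV.
Qed.

Lemma submodule_hecke_cycle_inv (P : qelem K n -> Prop) N m
    (F : forall A : algType (Kq K), ('I_n -> 'I_n -> A) -> word -> A) :
  submodule laurent_scalar P -> (m < N)%N ->
  (forall w, size w = N -> P (fun A t => hecke_cycle m (F A t) w)) ->
  forall w, size w = N -> P (fun A t => F A t w).
Proof.
move=> mP; elim: m => // m IHm mN PF; apply: IHm; first exact: ltnW.
move=> w sw; pose cycle v : qelem K n := fun A t => hecke m (hecke_cycle m (F A t)) v.
have Lc : laurent_scalar (adjacent (@hecke_coef K n) 0 m w - (q - q^-1)).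
  have lR := laurent_scalar_subring K; apply: (subringB lR); first exact: laurent_hecke_coef.
  by apply: (subringB lR); [exact: laurent_scalar_q|exact: laurent_scalar_qV].
have Pcycle v : size v = N -> P (cycle v) by apply: PF.
have := submodD mP (Pcycle _ (etrans (size_swap_at m w) sw)) (submodZ mP Lc (Pcycle w sw)).
by apply: (submod_eq mP) => A t _; rewrite [RHS](@hecke_inv _ m) ?sw.
Qed.

End Braiding.

(** * Moving minors to the left *)

Section Exchange.
Variables (K : fieldType) (n : nat).
Local Notation q := (qv K).
Local Notation sgn := ((- qv K)^-1).
Local Notation word := (seq 'I_n).
Implicit Types (x y i j : 'I_n) (u v w : word) (X Y Z : {set 'I_n}).

Definition qminor w Y : qelem K n := fun A t => minor t w Y.

(* The tensor product of the letter x with the q-antisymmetric tensor of Y. *)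
Definition letter_ext x Y u : Kq K :=
  if u is y :: u' then if y == x then ext_coef u' Y else 0 else 0.

Lemma laurent_letter_ext x Y u : laurent_scalar (letter_ext x Y u).
Proof.
have L0 := subring0 (laurent_scalar_subring K).
by case: u => [|y u] //=; case: ifP => // _; apply: laurent_ext_coef.
Qed.

Lemma mon_sum_letter_ext (A : algType (Kq K)) (t : 'I_n -> 'I_n -> A) i w x Y :
  mon_sum t (i :: w) (fun u => (letter_ext x Y u)%:A) = t i x * minor t w Y.
Proof.
rewrite /mon_sum (sum_tupleS _ (fun u => qmonomial t (i :: w) u * (letter_ext x Y u)%:A)).
rewrite (bigD1 x) //= eqxx [X in _ + X]big1 ?addr0 => [|y /negPf yx]; last first.
  by rewrite big1 // => u _; rewrite yx scale0r mulr0.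
rewrite mulr_sumr; apply: eq_bigr => u _.
by rewrite qmonomial_cons mulr_algr scalerAr.
Qed.

Lemma hecke_letter_ext k m x Y w : (k.+1 < m)%N -> size w = m.+1 ->
  hecke k.+1 (letter_ext x Y : word -> (Kq K)^o) w = sgn *: (letter_ext x Y w : (Kq K)^o).
Proof.
case: w => // y w km [sw]; have := @hecke_cat K n _ (letter_ext x Y : word -> (Kq K)^o) k [:: y] w.
rewrite add1n => ->; rewrite /= /hecke; case: (y == x); last by rewrite !scaler0 addr0.
exact: (@ext_coef_alternating K n m Y).
Qed.

Lemma hecke_cycle_letter_ext_alternating m x Y k :
  q_alternating m (fun u => hecke_cycle m (letter_ext x Y : word -> (Kq K)^o) (rcons u k)).
Proof.
move=> l w lm sw; rewrite -cats1.
transitivity (hecke l (hecke_cycle m (letter_ext x Y : word -> (Kq K)^o)) (w ++ [:: k])).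
  by rewrite hecke_catl ?sw //; apply: eq_hecke => u _; rewrite cats1.
have sk : size (w ++ [:: k]) = m.+1 by rewrite size_cat sw addn1.
rewrite hecke_hecke_cycle ?sk // -hecke_cycleZ; apply: eq_hecke_cycle => u su.
by apply: hecke_letter_ext lm _; rewrite su.
Qed.

Lemma mon_sum_rcons (A : algType (Kq K)) (t : 'I_n -> 'I_n -> A) w i (V : word -> (Kq K)^o) :
  (forall k, q_alternating (size w) (fun u => V (rcons u k))) ->
  mon_sum t (rcons w i) (fun u => (V u : Kq K)%:A)
  = \sum_(Z : {set 'I_n}) \sum_k (V (rcons (enum Z) k) : Kq K) *: (minor t w Z * t i k).
Proof.
move=> Valt; rewrite /mon_sum size_rcons -addn1.
rewrite (sum_tupleD _ _ (fun u => qmonomial t (rcons w i) u * (V u : Kq K)%:A)).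
transitivity (\sum_(u : (size w).-tuple 'I_n) \sum_k \sum_(Z : {set 'I_n})
    (V (rcons (enum Z) k) : Kq K) *: ((ext_coef u Z *: qmonomial t w u) * t i k)).
  apply: eq_bigr => u _.
  rewrite (sum_tuple1 (fun v => qmonomial t (rcons w i) (u ++ v) * (V (u ++ v) : Kq K)%:A)).
  apply: eq_bigr => k _; rewrite -cats1 qmonomial_cat ?size_tuple // qmonomial_cons qmonomial_nil.
  rewrite mulr1 cats1 mulr_algr.
  have /(q_alternatingE) -> : q_alternating (size u) (fun v => V (rcons v k)) by rewrite size_tuple.
  rewrite scaler_suml; apply: eq_bigr => Z _.
  by rewrite -scalerAl scalerA mulrC.
rewrite exchange_big; under eq_bigr => k _ do rewrite exchange_big.
rewrite exchange_big; apply: eq_bigr => Z _; apply: eq_bigr => k _ /=.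
by rewrite -scaler_sumr -mulr_suml.
Qed.

Lemma qminor_mon_lattice w Y : mon_lattice laurent_scalar (size w) (qminor w Y).
Proof.
have mM := @mon_lattice_submodule K n laurent_scalar (size w).
refine (submod_sum _ mM _) => u _; apply: (submodZ mM (x := qmon w u)).
  exact: laurent_ext_coef.
by apply: mon_lattice_mon; rewrite ?size_tuple.
Qed.

Definition minor_multiple m d (g : qelem K n) := exists X Y e,
  [/\ #|X| = m, #|Y| = m, mon_lattice laurent_scalar d e & g = (qminor (enum X) Y * e)%E].

Lemma qminor_submodule P w Y : submodule (@laurent_scalar K) P ->
  (forall X, arrangement X w -> #|X| = #|Y| -> P (qminor (enum X) Y)) -> P (qminor w Y).
Proof.
move=> mP PX; apply: (submod_eq mP (x := fun A t =>
    \sum_(X : {set 'I_n}) (ext_coef w X *: qminor (enum X) Y)%E A t)).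
  by move=> A t rt; apply/esym/minor_sort.
refine (submod_sum _ mP _) => X _; case: (eqVneq #|X| #|Y|) => XY; last first.
  apply: (submod_eq mP _ (submod0 mP)) => A t _.
  by rewrite /qscale /qminor minor_size ?scaler0 // -cardE.
case: (boolP (arrangement X w)) => wX.
  by apply: (submodZ mP); [exact: laurent_ext_coef|exact: PX].
apply: (submod_eq mP _ (submod0 mP)) => A t _.
by rewrite /qscale /ext_coef (negPf wX) scale0r.
Qed.

Lemma gen_minor_exchange i j w Y :
  qspan laurent_scalar (minor_multiple (size w) 1) (qgen i j * qminor w Y)%E.
Proof.
have mP := qspan_submodule laurent_scalar (minor_multiple (size w) 1).
pose F (A : algType (Kq K)) (t : 'I_n -> 'I_n -> A) u :=
  mon_sum t u (fun v => (letter_ext j Y v)%:A).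
apply: (submod_eq mP (x := fun A t => F A t (i :: w))).
  by move=> A t rt; apply: mon_sum_letter_ext.
apply: (@submodule_hecke_cycle_inv K n _ (size w).+1 (size w)) => // v.
case/lastP: v => // w' i'; rewrite size_rcons => -[sw'].
pose V : word -> Kq K := hecke_cycle (size w) (letter_ext j Y : word -> (Kq K)^o).
apply: (submod_eq mP (x := fun A t => \sum_(Z : {set 'I_n})
   (fun A t => \sum_k (V (rcons (enum Z) k) *: (qminor w' Z * qgen i' k))%E A t) A t)).
  move=> A t rt; rewrite /F hecke_cycle_mon_sum // -(@mon_sum_rcons A t w' i' V); last first.
    by move=> k; rewrite sw'; apply: hecke_cycle_letter_ext_alternating.
  apply: eq_bigr => u _; congr (_ * _); exact/esym/hecke_cycle_in_alg.
refine (submod_sum _ mP _) => Z _; refine (submod_sum _ mP _) => k _; apply: (submodZ mP).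
  exact/laurent_hecke_cycle/laurent_letter_ext.
apply: (qminor_submodule (submodule_mulr _ mP)) => X /card_arrangement sX sXZ; apply: qspan_gen.
exists X, Z, (qgen i' k); rewrite -sXZ sX sw'; split=> //; apply: mon_lattice_gen.
Qed.

Lemma minor_multipleM m d e (f z : qelem K n) : qspan laurent_scalar (minor_multiple m d) f ->
  mon_lattice laurent_scalar e z -> qspan laurent_scalar (minor_multiple m (d + e)) (f * z)%E.
Proof.
move=> Mf Mz; move: f Mf; apply: qspan_least; first exact/submodule_mulr/qspan_submodule.
move=> _ [X [Y [f [sX sY Mf ->]]]]; apply: (qspan_eq (x := (qminor (enum X) Y * (f * z))%E)).
  by move=> A t _; rewrite /qmul mulrA.
by apply: qspan_gen; exists X, Y, (f * z)%E; split=> //; apply: mon_latticeM.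
Qed.

Lemma mon_minor_exchange m k l (f z : qelem K n) X Y : #|X| = m -> #|Y| = m ->
  mon_lattice laurent_scalar k f -> mon_lattice laurent_scalar l z ->
  qspan laurent_scalar (minor_multiple m (k + l)) (f * (qminor (enum X) Y * z))%E.
Proof.
move=> sX sY Mf Mz; move: f Mf; apply: qspan_least; first exact/submodule_mulr/qspan_submodule.
move=> _ [w [u [sw su ->]]]; elim: w u k sw su => [|i w IHw] [|j u] [|k] //=.
  move=> _ _; apply: (qspan_eq (x := (qminor (enum X) Y * z)%E)); last first.
    by apply: qspan_gen; exists X, Y, z.
  by move=> A t _; rewrite /qmul /qmon qmonomial_nil mul1r.
move=> [sw] [su]; apply: (qspan_eq (x := (qgen i j * (qmon w u * (qminor (enum X) Y * z)))%E)).
  by move=> A t _; rewrite /qmul /qmon qmonomial_cons !mulrA.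
move: (qmon w u * _)%E (IHw u k sw su).
apply: qspan_least; first exact/submodule_mull/qspan_submodule.
move=> _ [X1 [Y1 [e [sX1 sY1 Me ->]]]].
apply: (qspan_eq (x := (qgen i j * qminor (enum X1) Y1 * e)%E)).
  by move=> A t _; rewrite /qmul mulrA.
have := gen_minor_exchange i j (enum X1) Y1; rewrite -cardE sX1 => /minor_multipleM exchange.
by rewrite addSn -add1n; apply: exchange.
Qed.

End Exchange.

(** * Bitableaux modulo q *)

Section MinorModQ.
Variables (K : fieldType) (n : nat).
Local Notation q := (qv K).
Local Notation sgn := ((- qv K)^-1).
Local Notation word := (seq 'I_n).
Local Notation ltI := (fun x y : 'I_n => (x < y)%N).
Implicit Types (c u : word) (Y : {set 'I_n}).

Lemma inversions_rev_sorted c : sorted ltI c -> inversions (rev c) = 'C(size c, 2).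
Proof.
move=> Sc; have Uc := lt_sorted_uniq Sc; rewrite -inversions_rev //.
by have := inversions_eq0 Uc; rewrite Sc => /eqP->.
Qed.

(* Reading the rows in decreasing order makes the coefficients polynomial in q. *)
Lemma minor_rev (A : algType (Kq K)) (t : 'I_n -> 'I_n -> A) c Y :
  qmat_rel t -> sorted ltI c -> minor t c Y =
  \sum_(u : (size c).-tuple 'I_n | arrangement Y u)
    (- q) ^+ inversions (rev u) *: qmonomial t (rev c) u.
Proof.
move=> rt Sc; have Uc := lt_sorted_uniq Sc.
have qsgn m : (- q) ^+ m * sgn ^+ m = 1 by rewrite -exprMn divff ?expr1n // oppr_eq0 qv_neq0.
have -> : minor t c Y = (- q) ^+ inversions (rev c) *: minor t (rev c) Y.
  have cE : [set x in rev c] = [set x in c] by apply/setP=> x; rewrite !inE mem_rev.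
  rewrite (minor_sort rt (rev c)) (bigD1 [set x in c]) //= big1 ?addr0 => [|X /negPf XC].
    by rewrite enum_sorted // /ext_coef /arrangement rev_uniq Uc cE eqxx scalerA qsgn scale1r.
  by rewrite /ext_coef /arrangement cE eq_sym XC andbF scale0r.
rewrite (minor_sum _ _ (size_rev c)) scaler_sumr [RHS]big_mkcond; apply: eq_bigr => u _.
rewrite /ext_coef; case: ifP => [/andP[Uu _]|_]; last by rewrite scale0r scaler0.
have := inversions_rev Uu; rewrite size_tuple -inversions_rev_sorted // => <-.
by rewrite scalerA addnC exprD -mulrA qsgn mulr1.
Qed.

Lemma poly_qNX m : poly_scalar ((- q) ^+ m).
Proof.
have pR := poly_scalar_subring K.
by apply: (subringX pR); apply: (subringN pR); apply: poly_scalar_q.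
Qed.

Lemma qminor_poly_lattice c Y : sorted ltI c ->
  mon_lattice poly_scalar (size c) (qminor c Y : qelem K n).
Proof.
move=> Sc; have mM := @mon_lattice_submodule K n poly_scalar (size c).
apply: (submod_eq mM (x := fun A t => \sum_(u : (size c).-tuple 'I_n | arrangement Y u)
   ((- q) ^+ inversions (rev u) *: qmon (rev c) u)%E A t)).
  by move=> A t rt; rewrite /qminor minor_rev.
refine (submod_sum _ mM _) => u _; apply: (submodZ mM (poly_qNX _)).
by apply: mon_lattice_mon; rewrite ?size_rev ?size_tuple.
Qed.

Lemma cong_qminor c Y : sorted ltI c -> #|Y| = size c ->
  cong_mod_q (size c) (qminor c Y : qelem K n) (qmon (rev c) (rev (enum Y))).
Proof.
move=> Sc sY; have mV := @vanish_submodule K n (size c).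
have sE : size (rev (enum Y)) == size c by rewrite size_rev -cardE sY.
apply: (submod_eq mV (x := fun A t =>
   \sum_(u : (size c).-tuple 'I_n | arrangement Y u && (u != Tuple sE))
   ((- q) ^+ inversions (rev u) *: qmon (rev c) u)%E A t)) => [A t rt|].
  rewrite /qsub /qminor minor_rev // [in RHS](bigD1 (Tuple sE)) /=; last first.
    by rewrite /arrangement rev_uniq enum_uniq /=; apply/eqP/setP=> x; rewrite inE mem_rev mem_enum.
  rewrite revK (eqP (_ : inversions (enum Y) == 0%N));
    last by rewrite inversions_eq0 ?enum_uniq ?sorted_enum.
  by rewrite scale1r [X in _ = X - _]addrC addrK.
refine (submod_sum _ mV _) => u /andP[/andP[Uu /eqP uY] uE].
have : inversions (rev u) != 0%N.
  rewrite inversions_eq0 ?rev_uniq //; apply: contra uE => Su; apply/eqP/val_inj/(can_inj revK).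
  rewrite /= revK; apply: lt_sorted_eq Su (sorted_enum Y) _ => x.
  by rewrite mem_rev mem_enum -uY inE.
case: (inversions (rev u)) => // m _.
exists (- (- q) ^+ m *: qmon (rev c) u)%E; last first.
  by move=> A t _; rewrite /qscale scalerA exprS mulrN mulNr.
apply/qspanZ/mon_lattice_mon; rewrite ?size_rev ?size_tuple //.
exact: subringN (poly_scalar_subring K) _ (poly_qNX m).
Qed.

End MinorModQ.

Section Determinant.
Variables (K : fieldType) (n : nat).
Local Notation sgn := ((- qv K)^-1).
Local Notation word := (seq 'I_n).
Local Notation ltI := (fun x y : 'I_n => (x < y)%N).

Lemma inv_count_sum m (w : 'S_m) :
  inv_count w = (\sum_(i < m) \sum_(j < m) ((i < j) && (w j < w i)))%N.
Proof.
rewrite /inv_count -sum1_card pair_big_dep /= big_mkcond /=.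
by apply: eq_bigr => -[i j] _; rewrite inE /=; case: ifP.
Qed.

Lemma inversions_sum m (f : 'I_m -> 'I_n) :
  inversions [seq f i | i <- enum 'I_m] = (\sum_(i < m) \sum_(j < m) ((i < j) && (f j < f i)))%N.
Proof.
elim: m f => [|m IHm] f; first by rewrite big_ord0 (size0nil (size_enum_ord 0)).
rewrite enum_ordSl /= -map_comp IHm !big_ord_recl ltnn add0n count_map -sum1_count.
rewrite big_mkcond big_enum /=; congr (_ + _)%N.
by apply: eq_bigr => i _; rewrite big_ord_recl.
Qed.

Section Model.
Variables (A : algType (Kq K)) (t : 'I_n -> 'I_n -> A).

Lemma qmonomial_tnth m (w u : m.-tuple 'I_n) :
  qmonomial t w u = \prod_(k < m) t (tnth w k) (tnth u k).
Proof.
rewrite /qmonomial (big_tuple _ _ (zip_tuple w u)); apply: eq_bigr => k _.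
by rewrite (tnth_nth (tnth w k, tnth u k)) /= nth_zip ?size_tuple // -!tnth_nth.
Qed.

Lemma sum_perm_minor m (I J : m.-tuple 'I_n) : sorted ltI J ->
  \sum_(w : 'S_m) sgn ^+ inv_count w *: \prod_(k < m) t (tnth I k) (tnth J (w k))
  = minor t I [set x in J].
Proof.
move=> SJ; have UJ := lt_sorted_uniq SJ.
pose arr (w : 'S_m) := [tuple tnth J (w k) | k < m].
have arr_inj : injective arr.
  move=> w w' arrE; apply/permP=> k; have /tuple_uniqP tJ := UJ; apply: tJ.
  by have := congr1 (fun u => tnth u k) arrE; rewrite !tnth_mktuple.
transitivity (\sum_(u in arr @: 'S_m) sgn ^+ inversions u *: qmonomial t I u).
  rewrite big_imset /=; last by move=> w w' _ _; apply: arr_inj.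
  apply: eq_big => [w|w _]; first by rewrite inE.
  rewrite [qmonomial _ _ _](qmonomial_tnth I (arr w)) inversions_sum inv_count_sum.
  congr (sgn ^+ _ *: _); last by apply: eq_bigr => k _; rewrite tnth_mktuple.
  apply: eq_bigr => i _; apply: eq_bigr => j _; congr (nat_of_bool (_ && _)).
  rewrite !(tnth_nth (tnth J i) J (w _)); apply/esym/(@lt_sorted_ltn_nth _ 'I_n _ _ SJ).
    by rewrite inE size_tuple.
  by rewrite inE size_tuple.
rewrite (minor_sum _ _ (size_tuple I)) big_mkcond; apply: eq_bigr => u _.
have -> : (u \in arr @: 'S_m) = arrangement [set x in J] u.
  have -> : arrangement [set x in J] u = perm_eq u J.
    apply/andP/idP => [[Uu /eqP uJ]|uJ]; last first.
      rewrite (perm_uniq uJ); split=> //; apply/eqP/setP=> x.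
      by rewrite !inE (perm_mem uJ).
    by apply: uniq_perm => // x; have := in_set (mem u) x; rewrite uJ inE.
  apply/imsetP/tuple_permP => [[w _ ->]|[w uE]]; first by exists w.
  by exists w => //; apply: val_inj.
by rewrite /ext_coef; case: ifP; rewrite // scale0r.
Qed.

Lemma qdet_minor (I J : word) :
  size I = size J -> sorted ltI J -> qdet t I J = minor t I [set x in J].
Proof.
move=> sIJ SJ; have sJ : size J == size I by rewrite sIJ.
rewrite -[J]/(val (Tuple sJ)) -[I in RHS]/(val (in_tuple I)) -sum_perm_minor //.
apply: eq_bigr => w _; congr (_ *: _); apply: eq_bigr => k _.
by rewrite [tnth (Tuple sJ) _](tnth_nth (tnth (in_tuple I) k)).
Qed.

End Model.
End Determinant.

Section Bitableaux.
Variables (K : fieldType) (n : nat).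
Implicit Types (T : tableau n) (w u : seq 'I_n).

Definition qbitab T T' : qelem K n := fun A t => bitab t T T'.

Lemma qbitab_nil : qbitab [::] [::] =~ 1%E.
Proof. by move=> A t _; rewrite /qbitab /bitab big_ord0. Qed.

Lemma size_head_gt0 T : is_tab T -> (0 < size (head [::] T))%N = (T != [::]).
Proof. by case: T => // r T; rewrite is_tab_cons lt0n size_eq0 => /andP[-> _]. Qed.

Lemma qbitab_drop_column T T' : is_tab T -> is_tab T' -> shape T = shape T' -> T != [::] ->
  qbitab T T' =~ (qminor (column T 0) [set x in column T' 0]
                  * qbitab (drop_column T) (drop_column T'))%E.
Proof.
move=> tT tT' sh T0 A t _.
have sT' : size T' = size T := esym (eq_size_shape sh).
rewrite /qmul /qbitab /bitab size_head_drop_column //.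
have : (0 < size (head [::] T))%N by rewrite size_head_gt0.
case: (size _) => // m _; rewrite big_ord_recl /=; congr (_ * _).
  by rewrite qdet_minor ?sorted_column0 // !size_column0.
by apply: eq_bigr => k _; rewrite !column_drop_column.
Qed.

Lemma bitab_induction (P : tableau n -> tableau n -> Prop) : P [::] [::] ->
  (forall T T', is_tab T -> is_tab T' -> shape T = shape T' -> T != [::] ->
     P (drop_column T) (drop_column T') -> P T T') ->
  forall T T', is_tab T -> is_tab T' -> shape T = shape T' -> P T T'.
Proof.
move=> P0 PS T; move sT: (size (head [::] T)) => m; elim: m T sT => [|m IHm] T sT T' tT tT' sh.
  have T0 : T = [::] by apply/eqP; have := size_head_gt0 tT; rewrite sT; case: eqP.
  by rewrite T0 in sh *; case: T' sh {tT'}.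
apply: PS => //; first by rewrite -size_head_gt0 // sT.
apply: IHm; rewrite ?is_tab_drop_column // ?size_head_drop_column ?sT //.
exact: shape_drop_column.
Qed.

Lemma qbitab_mod_q T T' : is_tab T -> is_tab T' -> shape T = shape T' ->
  mon_lattice poly_scalar (size (row_word T)) (qbitab T T') /\
  cong_mod_q (size (row_word T)) (qbitab T T') (qmon (row_word T) (row_word T')).
Proof.
move: T T'; apply: bitab_induction => [|T T' tT tT' sh T0 [ML CL]].
  have nilE : qmon [::] [::] =~ qbitab [::] [::].
    by move=> A t rt; rewrite /qmon qmonomial_nil qbitab_nil.
  split; first by apply: (qspan_eq nilE); apply: mon_lattice_mon.
  by apply: cong_eq => A t rt; rewrite -nilE.
have [Sc Sc'] := (sorted_column0 tT, sorted_column0 tT').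
have [sc sc'] := (size_column0 tT, size_column0 tT').
have sT' : size T' = size T := esym (eq_size_shape sh).
have sY : #|[set x in column T' 0]| = size (column T 0).
  by rewrite cardsE (card_uniqP (lt_sorted_uniq Sc')) sc sc' sT'.
have sw : size (row_word (drop_column T')) = size (row_word (drop_column T)).
  by rewrite !size_row_word (shape_drop_column sh).
have MC := @qminor_poly_lattice K n _ [set x in column T' 0] Sc.
have QE := qbitab_drop_column tT tT' sh T0.
rewrite size_row_word_drop_column // -sc; split.
  by apply: (submod_eq (mon_lattice_submodule _ _) (fun A t rt => esym (QE A t rt)));
    apply: mon_latticeM.
apply: cong_trans (cong_eq _ QE) _.
apply: cong_trans (congM MC _ (cong_qminor K Sc sY) CL) _; first by apply: mon_lattice_mon.
have [ks pathP] := column_knuth_path n (shape T).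
have sTw : size (row_word T) = size (row_word T') by rewrite !size_row_word sh.
have to_row_word := cong_sym (cong_knuth_path K sTw (pathP T erefl tT) (pathP T' (esym sh) tT')).
rewrite size_row_word_drop_column // -sc in to_row_word.
apply: cong_trans to_row_word; apply: cong_eq => A t _.
by rewrite /qmul /qmon qmonomial_cat ?enum_sorted // !size_rev sc sc' sT'.
Qed.

Definition RS_bitab w u : qelem K n :=
  fun A t => if (RS w).2 == (RS u).2 then bitab t (RS w).1 (RS u).1 else 0.

Lemma cong_RS_bitab w u : size w = size u -> cong_mod_q (size w) (qmon w u) (RS_bitab w u).
Proof.
move=> swu; have [QE|QN] := eqVneq (RS w).2 (RS u).2; last first.
  apply: (submod_eq (vanish_submodule _) _ (vanish_separated K swu (separated_RS swu QN))) => A t _.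
  by rewrite /qsub /RS_bitab (negPf QN) subr0.
have [ks pathP] := RS_knuth_path w.
apply: cong_trans (cong_knuth_path K swu (pathP w erefl erefl) (pathP u (esym swu) (esym QE))) _.
have sh : shape (RS w).1 = shape (RS u).1 by rewrite !shape_RS QE.
have [_ /cong_sym] := qbitab_mod_q (is_tab_RS w) (is_tab_RS u) sh; rewrite size_row_word_RS.
by move/cong_trans; apply; apply: cong_eq => A t _; rewrite /RS_bitab QE eqxx.
Qed.

End Bitableaux.

(** * Garnir relations *)

Section Garnir.
Variables (K : fieldType) (n : nat).
Local Notation q := (qv K).
Local Notation word := (seq 'I_n).
Local Notation elt := (qelem K n).
Local Notation laurent := (@laurent_scalar K).
Implicit Types (c d w : word) (X Y Z U : {set 'I_n}).

Definition entry_sum X : nat := (\sum_(x in X) x)%N.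

Lemma entry_sum_arrangement X w : arrangement X w -> entry_sum X = (\sum_(x <- w) x)%N.
Proof.
by case/andP=> Uw /eqP <-; rewrite big_uniq //; apply: eq_bigl => x; rewrite inE.
Qed.

Lemma entry_sum_exchange X S D : X \subset D :|: S -> #|X| = #|S| -> X != S ->
  (forall x y : 'I_n, x \in D -> y \in S -> (x < y)%N) -> (entry_sum X < entry_sum S)%N.
Proof.
move=> XDS sXS XS DS.
rewrite /entry_sum (big_setID S) [X in (_ < X)%N](big_setID X) /= setIC ltn_add2l.
have sD : #|X :\: S| = #|S :\: X|.
  by have := cardsID S X; have := cardsID X S; rewrite setIC sXS; lia.
have [y0 y0S] : exists y, y \in S :\: X.
  apply/set0Pn; rewrite setD_eq0; apply: contra XS => SX.
  by rewrite eq_sym eqEcard SX sXS leqnn.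
have [b /setDP[bS _] bmin] := arg_minnP val y0S.
apply: (@leq_trans (\sum_(y in S :\: X) b)%N); last first.
  by apply: leq_sum => y /bmin.
rewrite sum_nat_const -sD -sum_nat_const.
have : (0 < #|X :\: S|)%N by rewrite sD card_gt0; apply/set0Pn; exists y0.
suff : (\sum_(x in X :\: S) x.+1 <= \sum_(x in X :\: S) b)%N.
  under eq_bigr => x _ do rewrite -addn1; rewrite big_split /= sum1_card => sum_le pos.
  by apply: leq_trans sum_le; rewrite -[X in (X < _)%N]addn0 ltn_add2l.
apply: leq_sum => x /setDP[xX xS]; apply: DS bS.
by move/subsetP: XDS => /(_ x xX); rewrite inE (negPf xS) orbF.
Qed.

Lemma garnir_expansion (A : algType (Kq K)) (t : 'I_n -> 'I_n -> A) c d Z Y Y' : qmat_rel t ->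
  \sum_(X : {set 'I_n} * {set 'I_n}) ext_coef (enum X.1 ++ enum X.2) Z *:
    (minor t (c ++ enum X.1) Y * minor t (enum X.2 ++ d) Y') =
  \sum_(J : {set 'I_n} * {set 'I_n}) \sum_(L : {set 'I_n} * {set 'I_n}) \sum_(U : {set 'I_n})
    (ext_coef (enum J.1 ++ enum J.2) Y * ext_coef (enum L.1 ++ enum L.2) Y'
       * ext_coef (enum J.2 ++ enum L.1) U) *:
    (minor t c J.1 * (minor t (enum Z) U * minor t d L.2)).
Proof.
move=> rt; have rt' := qmat_rel_transpose rt.
transitivity (\sum_(X : {set 'I_n} * {set 'I_n}) \sum_(J : {set 'I_n} * {set 'I_n})
    \sum_(L : {set 'I_n} * {set 'I_n})
  (ext_coef (enum J.1 ++ enum J.2) Y * ext_coef (enum L.1 ++ enum L.2) Y') *: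
  (minor t c J.1 * (ext_coef (enum X.1 ++ enum X.2) Z *:
     (minor t (enum X.1) J.2 * minor t (enum X.2) L.1) * minor t d L.2))).
  apply: eq_bigr => X _; rewrite !minor_cat mulr_suml scaler_sumr.
  apply: eq_bigr => J _; rewrite mulr_sumr scaler_sumr; apply: eq_bigr => L _.
  rewrite -!scalerAl -!scalerAr !scalerA !mulrA; congr (_ *: _).
  by rewrite -mulrA mulrC.
rewrite exchange_big; apply: eq_bigr => J _; rewrite exchange_big; apply: eq_bigr => L _ /=.
rewrite -scaler_sumr -mulr_sumr -mulr_suml.
have -> : \sum_(X : {set 'I_n} * {set 'I_n}) ext_coef (enum X.1 ++ enum X.2) Z *:
      (minor t (enum X.1) J.2 * minor t (enum X.2) L.1)
    = minor (transpose_gen t) (enum J.2 ++ enum L.1) Z.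
  by rewrite minor_cat; apply: eq_bigr => X _; rewrite !(minor_transpose _ _ rt).
rewrite (minor_sort rt') [X in _ *: (_ * X)]mulr_suml [X in _ *: X]mulr_sumr scaler_sumr.
apply: eq_bigr => U _.
by rewrite -(minor_transpose _ _ rt) -scalerAl -scalerAr scalerA.
Qed.

Lemma garnir_expansion_submodule (P : elt -> Prop) c d Z Y Y' : submodule laurent P ->
  (forall f U g, mon_lattice laurent (size c) f -> #|U| = #|Z| -> mon_lattice laurent (size d) g ->
     P (f * (qminor (enum Z) U * g))%E) ->
  P (fun A t => \sum_(X : {set 'I_n} * {set 'I_n}) ext_coef (enum X.1 ++ enum X.2) Z *:
       (minor t (c ++ enum X.1) Y * minor t (enum X.2 ++ d) Y')).
Proof.
move=> mP PZ; have lR := laurent_scalar_subring K.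
apply: (submod_eq mP (fun A t rt => esym (garnir_expansion c d Z Y Y' rt))).
refine (submod_sum _ mP _) => J _; refine (submod_sum _ mP _) => L _;
  refine (submod_sum _ mP _) => U _.
apply: (submodZ mP (x := (qminor c J.1 * (qminor (enum Z) U * qminor d L.2))%E)).
  by do 2?apply: (subringM lR); apply: laurent_ext_coef.
case: (eqVneq #|U| #|Z|) => sU; first by apply: PZ sU _; apply: qminor_mon_lattice.
apply: (submod_eq mP _ (submod0 mP)) => A t _.
by rewrite /qmul /qminor [minor t (enum Z) U]minor_size ?mul0r ?mulr0 // -cardE eq_sym.
Qed.

Inductive garnir_correction X Y X' Y' r : elt -> Prop :=
| GarnirLower X1 X1' : #|X1| = #|X| -> #|X1'| = #|X'| -> (entry_sum X1 < entry_sum X)%N ->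
    garnir_correction X Y X' Y' r (qminor (enum X1) Y * qminor (enum X1') Y')%E
| GarnirLonger f Z U g : #|Z| = #|X|.+1 -> #|U| = #|X|.+1 ->
    mon_lattice laurent r f -> mon_lattice laurent (#|X'| - r.+1) g ->
    garnir_correction X Y X' Y' r (f * (qminor (enum Z) U * g))%E.

Section Relation.
Variables (X Y X' Y' : {set 'I_n}) (r : nat) (x0 : 'I_n).
Hypotheses (sXY : #|X| = #|Y|) (sXY' : #|X'| = #|Y'|) (rX' : (r < #|X'| <= #|X|)%N).
Hypothesis violation : (nth x0 (enum X') r < nth x0 (enum X) r)%N.

Let c := take r (enum X).
Let b := drop r (enum X).
Let c' := take r.+1 (enum X').
Let b' := drop r.+1 (enum X').
Let Z := [set x in b ++ c'].

Let sizes : [/\ size c = r, size b = (#|X| - r)%N, size c' = r.+1 & size b' = (#|X'| - r.+1)%N].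
Proof.
have /andP[rX rX''] := rX'; rewrite !size_drop !size_takel -!cardE //.
exact: leq_trans (ltnW rX) rX''.
Qed.

Lemma garnir_lt x y : x \in c' -> y \in b -> (x < y)%N.
Proof.
have /andP[rX rX''] := rX'; have le_nth (W : {set 'I_n}) k l :
    (k <= l < #|W|)%N -> (nth x0 (enum W) k <= nth x0 (enum W) l)%N.
  rewrite cardE => /andP[kl lW]; have := @lt_sorted_leq_nth _ 'I_n x0 _ (sorted_enum W) k l.
  by rewrite !inE lW (leq_ltn_trans kl lW) kl => /(_ isT isT).
have [_ sb sc' _] := sizes.
move=> /(nthP x0)[i]; rewrite sc' ltnS => ir <-; move=> /(nthP x0)[j]; rewrite sb => jr <-.
rewrite nth_take // nth_drop; apply: leq_ltn_trans (le_nth X' i r _) _; first by rewrite ir.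
by apply: leq_trans violation (le_nth X _ _ _); rewrite leq_addr; lia.
Qed.

Lemma garnir_uniq : uniq (b ++ c').
Proof.
rewrite cat_uniq drop_uniq ?take_uniq ?enum_uniq //= andbT; apply/hasPn=> x xc'.
by apply/negP=> xb; have := garnir_lt xc' xb; rewrite ltnn.
Qed.

Lemma garnir_card : #|Z| = #|X|.+1.
Proof.
have [_ sb sc' _] := sizes; rewrite cardsE (card_uniqP garnir_uniq) size_cat sb sc' addnS subnK //.
by case/andP: rX' => /ltnW; apply: leq_trans.
Qed.

Local Notation correction := (garnir_correction X Y X' Y' r).

Lemma garnir_other_term X1 X2 : (X1, X2) != ([set x in b], [set x in c']) ->
  qspan laurent correction (ext_coef (enum X1 ++ enum X2) Z *:
    (qminor (c ++ enum X1) Y * qminor (enum X2 ++ b') Y'))%E.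
Proof.
move=> X12; have mG := qspan_submodule laurent correction.
have [sc sb sc' sb'] := sizes.
case: (boolP (arrangement Z (enum X1 ++ enum X2))) => [/andP[U12 /eqP Z12]|NZ]; last first.
  by apply: (submod_eq mG _ (submod0 mG)) => A t _; rewrite /qscale /ext_coef (negPf NZ) scale0r.
have inZ x : (x \in X1) || (x \in X2) = (x \in b) || (x \in c').
  by have /setP/(_ x) := Z12; rewrite !inE !mem_cat !mem_enum.
have X1b : X1 != [set x in b].
  apply: contra X12 => /eqP X1E; rewrite xpair_eqE X1E eqxx /=; apply/eqP/setP=> x.
  have := inZ x; rewrite X1E !inE; case: (boolP (x \in b)) => //= xb _.
  have -> : x \in c' = false by apply/negP=> xc'; have := garnir_lt xc' xb; rewrite ltnn.
  apply/negP=> xX2; move: U12; rewrite cat_uniq => /and3P[_ /hasPn/(_ x)].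
  by rewrite !mem_enum X1E inE xX2 xb => /(_ isT).
apply: (submodZ mG); first exact: laurent_ext_coef.
apply: (qminor_submodule (submodule_mulr _ mG)) => W arrW sW.
apply: (qminor_submodule (submodule_mull _ mG)) => W' _ sW'.
apply: qspan_gen; apply: GarnirLower; rewrite ?sW ?sW' //.
have XE : arrangement X (c ++ b) by rewrite cat_take_drop arrangement_enum.
rewrite (entry_sum_arrangement arrW) (entry_sum_arrangement XE) !big_cat ltn_add2l /=.
rewrite -(entry_sum_arrangement (arrangement_enum X1)).
have barr : arrangement [set x in b] b by rewrite /arrangement drop_uniq ?enum_uniq ?eqxx.
rewrite -(entry_sum_arrangement barr); apply: (@entry_sum_exchange _ _ [set x in c']) => //.
- by apply/subsetP=> x xX1; rewrite !inE orbC -inZ xX1.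
- rewrite cardsE (card_uniqP _) ?drop_uniq ?enum_uniq // sb -sc.
  by rewrite sXY -sW (card_arrangement arrW) size_cat addKn cardE.
- by move=> x y; rewrite !inE; apply: garnir_lt.
Qed.

(* Antisymmetrizing the entries of the first column from row r on together with the entries of
   the second column up to row r gives a combination of longer minors; the leading term of the
   sum is the given product. *)
Lemma garnir_relation :
  qspan laurent correction (qminor (enum X) Y * qminor (enum X') Y')%E.
Proof.
have mG := qspan_submodule laurent correction; have lR := laurent_scalar_subring K.
have [sc _ _ sb'] := sizes.
pose term (V : {set 'I_n} * {set 'I_n}) : elt := (ext_coef (enum V.1 ++ enum V.2) Z *:
    (qminor (c ++ enum V.1) Y * qminor (enum V.2 ++ b') Y'))%E.
have Gsum : qspan laurent correction (fun A t => \sum_V term V A t).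
  apply: (@garnir_expansion_submodule _ c b' Z Y Y' mG) => f U g.
  rewrite sc sb' garnir_card => Mf sU Mg.
  by apply: qspan_gen; apply: GarnirLonger; rewrite ?garnir_card.
pose M := ([set x in b], [set x in c']).
have Gother : qspan laurent correction (fun A t => \sum_(V | V != M) term V A t).
  by refine (submod_sum _ mG _) => -[X1 X2]; apply: garnir_other_term.
have Lq : laurent ((- q) ^+ inversions (b ++ c')).
  by apply: (subringX lR); apply: (subringN lR); apply: laurent_scalar_q.
apply: (submod_eq mG _ (submodZ mG Lq (submodB lR mG Gsum Gother))) => A t _.
rewrite /qscale /qsub (bigD1 M) //= addrK /term /qscale /qmul /qminor.
have [Eb Ec'] : enum [set x in b] = b /\ enum [set x in c'] = c'.
  by split; apply: enum_sorted; [apply: drop_sorted|apply: take_sorted]; apply: sorted_enum.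
rewrite /M Eb Ec' !cat_take_drop /ext_coef /arrangement garnir_uniq eqxx scalerA -exprMn.
by rewrite divff ?expr1n ?scale1r // oppr_eq0 qv_neq0.
Qed.

End Relation.
End Garnir.

(** * Straightening *)

Section Straightening.
Variables (K : fieldType) (n : nat).
Local Notation elt := (qelem K n).
Local Notation laurent := (@laurent_scalar K).
Implicit Types (T : tableau n) (X Y : {set 'I_n}) (f g : elt) (c w u : seq 'I_n).

Definition is_bitableau k g := exists T T' : tableau n,
  [/\ is_tab T, is_tab T', shape T = shape T', sumn (shape T) = k & g = qbitab T T'].

Definition bitab_lattice S k := qspan S (is_bitableau k).

Lemma bitab_lattice_submodule S k : submodule S (bitab_lattice S k).
Proof. exact: qspan_submodule. Qed.

Lemma bitab_lattice_bitab S T T' : is_tab T -> is_tab T' -> shape T = shape T' ->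
  bitab_lattice S (sumn (shape T)) (qbitab T T').
Proof. by move=> tT tT' sh; apply: qspan_gen; exists T, T'. Qed.

Definition qtranspose f : elt := fun A t => f A (transpose_gen t).

Lemma qtranspose_submodule S P : submodule S P -> submodule S (fun f => P (qtranspose f)).
Proof.
case=> P0 PD PZ Peq; split=> // [f g Pf Pg|c f cS Pf|f g fg Pf].
- exact: (PD _ _ Pf Pg).
- exact: (PZ _ _ cS Pf).
- by apply: Peq Pf => A t rt; apply/fg/qmat_rel_transpose.
Qed.

Lemma mon_lattice_transpose S k f : mon_lattice S k f -> mon_lattice S k (qtranspose f).
Proof.
move: f; apply: qspan_least; first exact/qtranspose_submodule/mon_lattice_submodule.
move=> _ [w [u [sw su ->]]]; apply: (qspan_eq (x := qmon u w)); last exact: mon_lattice_mon.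
by move=> A t _; rewrite /qtranspose /qmon qmonomial_transpose.
Qed.

Lemma qminor_transpose X Y : qtranspose (qminor (enum X) Y) =~ qminor (enum Y) X.
Proof. by move=> A t rt; rewrite /qtranspose /qminor (minor_transpose Y X rt). Qed.

Lemma qbitab_transpose T T' : is_tab T -> is_tab T' -> shape T = shape T' ->
  qtranspose (qbitab T T') =~ qbitab T' T.
Proof.
move: T T'; apply: bitab_induction => [|T T' tT tT' sh T0 IH A t rt].
  by move=> A t rt; rewrite /qtranspose !qbitab_nil //; apply: qmat_rel_transpose.
have T0' : T' != [::] by case: (T') sh => //; case: (T) T0.
rewrite (qbitab_drop_column tT' tT (esym sh) T0' rt) /qtranspose.
rewrite (qbitab_drop_column tT tT' sh T0 (qmat_rel_transpose rt)) /qmul -(IH A t rt).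
rewrite -{1}(enum_sorted (sorted_column0 tT)) -{2}(enum_sorted (sorted_column0 tT')).
by rewrite -(qminor_transpose _ _ rt).
Qed.

Lemma bitab_lattice_transpose S k f : bitab_lattice S k f -> bitab_lattice S k (qtranspose f).
Proof.
move: f; apply: qspan_least; first exact/qtranspose_submodule/bitab_lattice_submodule.
move=> _ [T [T' [tT tT' sh <- ->]]].
apply: (qspan_eq (x := qbitab T' T)).
  by move=> A t rt; rewrite qbitab_transpose.
by rewrite sh; apply: bitab_lattice_bitab.
Qed.

Lemma bitab_lattice_add_column S X Y T T' : #|X| = #|Y| -> (0 < #|X|)%N ->
  is_tab T -> is_tab T' -> shape T = shape T' -> (size T <= #|X|)%N ->
  column_le (enum X) T -> column_le (enum Y) T' ->
  bitab_lattice S (#|X| + sumn (shape T)) (qminor (enum X) Y * qbitab T T')%E.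
Proof.
rewrite !cardE => sXY X0 tT tT' sh sT cX cY.
have sT' : (size T' <= size (enum Y))%N by rewrite -sXY -(eq_size_shape sh).
have [SX SY] := (sorted_enum X, sorted_enum Y).
have tX := is_tab_add_column SX tT cX; have tY := is_tab_add_column SY tT' cY.
have shXY := shape_add_column sXY sh.
rewrite -sumn_shape_add_column //; apply: qspan_eq (bitab_lattice_bitab S tX tY shXY) => A t rt.
rewrite qbitab_drop_column // ?column0_add_column ?drop_add_column //; last by case: (enum X) X0.
by rewrite (_ : [set x in enum Y] = Y) //; apply/setP=> x; rewrite inE mem_enum.
Qed.

Definition minors_straighten k p := forall X Y f g a b, #|X| = p -> #|Y| = p ->
  mon_lattice laurent a f -> mon_lattice laurent b g -> (a + (p + b))%N = k ->
  bitab_lattice laurent k (f * (qminor (enum X) Y * g))%E.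

Lemma minors_straighten_left k p :
  (forall X Y g b, #|X| = p -> #|Y| = p -> mon_lattice laurent b g -> (p + b)%N = k ->
     bitab_lattice laurent k (qminor (enum X) Y * g)%E) -> minors_straighten k p.
Proof.
move=> left X Y f g a b sX sY Mf Mg abk; have := mon_minor_exchange sX sY Mf Mg.
apply: qspan_least; first exact: bitab_lattice_submodule.
by move=> _ [X1 [Y1 [e [sX1 sY1 Me ->]]]]; apply: left Me _; lia.
Qed.

Section ColumnPair.
Variables (k b r : nat) (x0 : 'I_n) (X Y X' Y' : {set 'I_n}) (g : elt).
Hypotheses (longer : minors_straighten k #|X|.+1) (Mg : mon_lattice laurent b g).
Hypotheses (sXY : #|X| = #|Y|) (sXY' : #|X'| = #|Y'|) (rX' : (r < #|X'| <= #|X|)%N).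
Hypothesis degree : (#|X| + (#|X'| + b))%N = k.

Lemma straighten_rows : (nth x0 (enum X') r < nth x0 (enum X) r)%N ->
  (forall X1 X1', #|X1| = #|X| -> #|X1'| = #|X'| -> (entry_sum X1 < entry_sum X)%N ->
     bitab_lattice laurent k (qminor (enum X1) Y * (qminor (enum X1') Y' * g))%E) ->
  bitab_lattice laurent k (qminor (enum X) Y * (qminor (enum X') Y' * g))%E.
Proof.
move=> violation lower; have mL := bitab_lattice_submodule laurent k.
apply: (submod_eq mL (x := ((qminor (enum X) Y * qminor (enum X') Y') * g)%E)).
  by move=> A t _; rewrite /qmul mulrA.
move: (_ * _)%E (garnir_relation K sXY sXY' rX' violation).
apply: qspan_least; first exact: submodule_mulr.
move=> _ [X1 X1' sX1 sX1' lt|f Z U h sZ sU Mf Mh].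
  by apply: (submod_eq mL _ (lower X1 X1' sX1 sX1' lt)) => A t _; rewrite /qmul mulrA.
have degreeE : (r + (#|X|.+1 + (#|X'| - r.+1 + b)))%N = k by case/andP: rX'; lia.
apply: (submod_eq mL _ (longer sZ sU Mf (mon_latticeM Mh Mg) degreeE)).
by move=> A t _; rewrite /qmul !mulrA.
Qed.

End ColumnPair.

Lemma straighten_columns k b r x0 X Y X' Y' g :
  minors_straighten k #|X|.+1 -> mon_lattice laurent b g ->
  #|X| = #|Y| -> #|X'| = #|Y'| -> (r < #|X'| <= #|X|)%N -> (#|X| + (#|X'| + b))%N = k ->
  (nth x0 (enum Y') r < nth x0 (enum Y) r)%N ->
  (forall Y1 Y1', #|Y1| = #|Y| -> #|Y1'| = #|Y'| -> (entry_sum Y1 < entry_sum Y)%N ->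
     bitab_lattice laurent k (qminor (enum X) Y1 * (qminor (enum X') Y1' * g))%E) ->
  bitab_lattice laurent k (qminor (enum X) Y * (qminor (enum X') Y' * g))%E.
Proof.
move=> longer Mg sXY sXY' rX' degree violation lower.
have mL := bitab_lattice_submodule laurent k.
have trE Y1 Y1' : qtranspose (qminor (enum X) Y1 * (qminor (enum X') Y1' * g))%E
    =~ (qminor (enum Y1) X * (qminor (enum Y1') X' * qtranspose g))%E.
  by move=> A t rt; rewrite /qmul -!(qminor_transpose _ _ rt).
suff : bitab_lattice laurent k (qtranspose (qminor (enum X) Y * (qminor (enum X') Y' * g))%E).
  exact: bitab_lattice_transpose.
apply: (submod_eq mL (fun A t rt => esym (trE Y Y' A t rt))).
apply: (@straighten_rows k b r x0); rewrite -?sXY -?sXY' //; first exact: mon_lattice_transpose.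
move=> Y1 Y1' sY1 sY1' lt; apply: (submod_eq mL (trE Y1 Y1')).
by apply: bitab_lattice_transpose; apply: lower; rewrite // ?sY1 ?sY1'.
Qed.

Lemma qbitab_first_column T T' : is_tab T -> is_tab T' -> shape T = shape T' -> T != [::] ->
  exists X Y g b, [/\ enum X = column T 0, enum Y = column T' 0, mon_lattice laurent b g,
    (size T + b)%N = sumn (shape T) & qbitab T T' =~ (qminor (enum X) Y * g)%E].
Proof.
move=> tT tT' sh T0; have QE := qbitab_drop_column tT tT' sh T0.
exists [set x in column T 0], [set x in column T' 0], (qbitab (drop_column T) (drop_column T')).
exists (size (row_word (drop_column T))).
rewrite !enum_sorted ?sorted_column0 //; split=> //.
  apply/laurent_mon_lattice; apply: (qbitab_mod_q K _ _ (shape_drop_column sh)).1;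
  exact: is_tab_drop_column.
by rewrite -size_row_word_drop_column // size_row_word.
Qed.

Section Induction.
Variables k p : nat.
Hypotheses (p_gt0 : (0 < p)%N) (longer : forall m, (p < m)%N -> minors_straighten k m).

Lemma straighten_violation X Y T T' : #|X| = p -> #|Y| = p ->
  is_tab T -> is_tab T' -> shape T = shape T' -> (p + sumn (shape T))%N = k ->
  ~~ [&& (size T <= p)%N, column_le (enum X) T & column_le (enum Y) T'] ->
  (forall X1 Y1 g, #|X1| = p -> #|Y1| = p ->
     (entry_sum X1 + entry_sum Y1 < entry_sum X + entry_sum Y)%N ->
     mon_lattice laurent (sumn (shape T)) g ->
     bitab_lattice laurent k (qminor (enum X1) Y1 * g)%E) ->
  bitab_lattice laurent k (qminor (enum X) Y * qbitab T T')%E.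
Proof.
move=> sX sY tT tT' sh degree nonstandard lower; have mL := bitab_lattice_submodule laurent k.
have sT' : size T' = size T := esym (eq_size_shape sh).
have T0 : T != [::].
  by case: (T) (T') sT' nonstandard => // -[] // _; rewrite !column_le_nil.
have [X' [Y' [g [b [EX EY Mg sumT QE]]]]] := qbitab_first_column tT tT' sh T0.
have sX' : #|X'| = size T by rewrite cardE EX size_column0.
have sY' : #|Y'| = size T by rewrite cardE EY size_column0 ?sT'.
apply: (submod_eq mL (x := (qminor (enum X) Y * (qminor (enum X') Y' * g))%E)).
  by move=> A t rt; rewrite /qmul (QE A t rt).
have [x0 _] : exists x0, x0 \in X by apply/set0Pn; rewrite -card_gt0 sX.
have Mtail X1 Y1 : #|X1| = size T ->
  mon_lattice laurent (sumn (shape T)) (qminor (enum X1) Y1 * g)%E.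
  move=> sX1; rewrite -sumT -sX1 cardE; apply: mon_latticeM Mg; exact: qminor_mon_lattice.
have [Tp|Tp] := leqP (size T) p; last first.
  have := longer Tp sX' sY' (@qminor_mon_lattice K n (enum X) Y) Mg; apply.
  by rewrite -cardE sX; lia.
move: nonstandard; rewrite Tp /= negb_and => /orP[viol|viol].
  have [|r rT viol'] := column_le_violation x0 tT _ viol; first by rewrite -cardE sX.
  apply: (@straighten_rows _ b r x0) => //; rewrite ?sX ?sY ?sX' ?sY' ?rT ?EX //.
  - exact: longer.
  - lia.
  - move=> X1 X1' sX1 sX1' lt; apply: lower; rewrite // ?ltn_add2r //; exact: Mtail.
have [|r rT viol'] := column_le_violation x0 tT' _ viol; first by rewrite -cardE sY sT'.
apply: (@straighten_columns _ b r x0) => //; rewrite ?sX ?sY ?sX' ?sY' -?sT' ?rT ?EY ?sT' //.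
- exact: longer.
- lia.
- by move=> Y1 Y1' sY1 sY1' lt; apply: lower; rewrite // ?ltn_add2l //; apply: Mtail.
Qed.

Hypothesis smaller : forall j f, (j < k)%N -> mon_lattice laurent j f -> bitab_lattice laurent j f.

Lemma minors_straighten_step : minors_straighten k p.
Proof.
apply: minors_straighten_left => X Y g b sX sY Mg degree.
have mL := bitab_lattice_submodule laurent k.
move: {2}(entry_sum X + entry_sum Y)%N (leqnn (entry_sum X + entry_sum Y)) => m.
elim/ltn_ind: m X Y sX sY g Mg => m IHm X Y sX sY g Mg leXY.
have bk : (b < k)%N by lia.
have {Mg} := smaller bk Mg; move: g; apply: qspan_least; first exact: submodule_mull.
move=> _ [T [T' [tT tT' sh sumT ->]]].
case: (boolP [&& (size T <= p)%N, column_le (enum X) T & column_le (enum Y) T']); last first.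
  move=> nonstandard; apply: straighten_violation => //; first by rewrite sumT.
  move=> X1 Y1 g sX1 sY1 lt; rewrite sumT => Mg.
  exact: (IHm _ (leq_trans lt leXY) X1 Y1 sX1 sY1 g Mg (leqnn _)).
case/and3P=> Tp cX cY; rewrite -degree -sumT -sX.
by apply: bitab_lattice_add_column; rewrite ?sX ?sY.
Qed.

End Induction.

Lemma qminor_set1 i j : qminor (enum [set i]) [set j] =~ (qgen i j : elt).
Proof.
move=> A t _; rewrite /qminor enum_set1 (minor_sum t _ (erefl : size [:: i] = 1%N)).
rewrite (sum_tuple1 (fun u => ext_coef u [set j] *: qmonomial t [:: i] u)).
have coef y : ext_coef [:: y] [set j] = (y == j)%:R :> Kq K.
  have yE : [set x in [:: y]] = [set y] by apply/setP=> x; rewrite !inE.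
  by rewrite /ext_coef /arrangement /= yE (inj_eq set1_inj); case: eqP.
rewrite (bigD1 j) //= big1 ?addr0 => [|y /negPf yj]; last by rewrite coef yj scale0r.
by rewrite coef eqxx scale1r qmonomial_cons qmonomial_nil mulr1.
Qed.

Lemma straightening k f : mon_lattice laurent k f -> bitab_lattice laurent k f.
Proof.
elim/ltn_ind: k f => k IHk; have mL := bitab_lattice_submodule laurent k.
have straighten p : (0 < p)%N -> minors_straighten k p.
  move: {2}(k.+1 - p)%N (leqnn (k.+1 - p)) => d; elim: d p => [|d IHd] p dp p0.
    by move=> X Y f g a b _ _ _ _; lia.
  apply: minors_straighten_step => // [m pm|j f jk]; last exact: IHk.
  by apply: IHd; lia.
apply: qspan_least => // _ [[|i w] [[|j u] [sw su ->]]]; try by rewrite -su in sw.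
  apply: (submod_eq mL (x := qbitab [::] [::])).
    by move=> A t rt; rewrite qbitab_nil // /qmon qmonomial_nil.
  by rewrite -sw; apply: (@bitab_lattice_bitab laurent [::] [::]).
have M1 : mon_lattice laurent 0 (1%E : elt).
  apply: (qspan_eq (x := qmon [::] [::])); last exact: mon_lattice_mon.
  by move=> A t _; apply: qmonomial_nil.
have Mwu : mon_lattice laurent (size w) (qmon w u : elt).
  by apply: mon_lattice_mon => //; move: su; rewrite -sw => -[].
have := straighten 1%N isT _ _ _ _ _ _ (cards1 i) (cards1 j) M1 Mwu sw.
apply: (submod_eq mL) => A t rt.
by rewrite /qmul qminor_set1 // /qone mul1r /qmon qmonomial_cons.
Qed.

End Straightening.

(** * Integrality *)

Section Integrality.
Variables (K : fieldType) (n : nat).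
Local Notation q := (qv K).
Local Notation elt := (qelem K n).
Local Notation laurent := (@laurent_scalar K).
Local Notation poly := (@poly_scalar K).
Implicit Types (G : elt -> Prop) (x y z : elt) (w u : seq 'I_n).

Lemma clear_denominators G x : qspan laurent G x ->
  exists N, forall m, (N <= m)%N -> qspan poly G (q ^+ m *: x)%E.
Proof.
move: x; apply: qspan_least => [|g Gg]; last first.
  by exists 0%N => m _; apply/qspanZ/qspan_gen => //; apply: poly_scalar_qX.
have mZ m := submodule_scale (q ^+ m) (qspan_submodule poly G).
split.
- by exists 0%N => m _; apply: submod0 (mZ m).
- move=> x y [N1 clearx] [N2 cleary]; exists (N1 + N2)%N => m Nm.
  by apply: (submodD (mZ m)); [apply: clearx|apply: cleary]; lia.
- move=> c x [i ic] [N clearx]; exists (i + N)%N => m Nm.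
  apply: (qspan_eq _ (qspanZ ic (clearx (m - i)%N _))); last lia.
  move=> A t _; rewrite /qscale !scalerA mulrAC -exprD subnKC //.
  exact: leq_trans (leq_addr _ _) Nm.
- by move=> x y xy [N clearx]; exists N => m Nm; apply: (submod_eq (mZ m) xy); apply: clearx.
Qed.

Lemma mon_lattice_denominator k : exists N, forall x, mon_lattice poly k x ->
  bitab_lattice poly k (q ^+ N *: x)%E.
Proof.
have denominator (wu : k.-tuple 'I_n * k.-tuple 'I_n) : exists N, forall m, (N <= m)%N ->
    bitab_lattice poly k (q ^+ m *: qmon wu.1 wu.2)%E.
  by apply/clear_denominators/straightening/mon_lattice_mon; rewrite size_tuple.
have [f fP] := fin_all_exists denominator; exists (\max_wu f wu).
apply: qspan_least; first exact/submodule_scale/bitab_lattice_submodule.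
move=> _ [w [u [/eqP sw /eqP su ->]]].
by apply: (fP (Tuple sw, Tuple su)); apply: leq_bigmax.
Qed.

Lemma bitab_lattice_RS S w u : size w = size u -> bitab_lattice S (size w) (RS_bitab w u : elt).
Proof.
move=> swu; have [QE|QN] := eqVneq (RS w).2 (RS u).2; last first.
  by apply: (qspan_eq _ (qspan0 _ _)) => A t _; rewrite /RS_bitab (negPf QN).
rewrite -(size_row_word_RS w) size_row_word.
apply: (qspan_eq (x := qbitab (RS w).1 (RS u).1)); first by move=> A t _; rewrite /RS_bitab QE eqxx.
by apply: bitab_lattice_bitab; rewrite ?is_tab_RS // !shape_RS QE.
Qed.

Lemma mon_lattice_mod_q k x : mon_lattice poly k x ->
  exists2 y, bitab_lattice poly k y & cong_mod_q k x y.
Proof.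
have mV := @vanish_submodule K n k; have mL := @bitab_lattice_submodule K n poly k.
move: x; apply: qspan_least; first split.
- by exists 0%E; [exact: submod0 mL|exact: cong_eq].
- move=> x1 x2 [y1 L1 C1] [y2 L2 C2]; exists (y1 + y2)%E; first exact: (submodD mL).
  by apply: (submod_eq mV _ (submodD mV C1 C2)) => A t _; rewrite /qadd /qsub opprD addrACA.
- move=> c x cP [y Ly C]; exists (c *: y)%E; first exact: (submodZ mL).
  by apply: (submod_eq mV _ (submodZ mV cP C)) => A t _; rewrite /qscale /qsub scalerBr.
- move=> x x' xx' [y Ly C]; exists y => //; apply: cong_trans C.
  by apply: cong_eq => A t rt; rewrite xx'.
move=> _ [w [u [sw su ->]]]; have swu : size w = size u by rewrite sw.
by exists (RS_bitab w u); rewrite -sw; [apply: bitab_lattice_RS|apply: cong_RS_bitab].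
Qed.

Lemma mon_lattice_mod_qX k N x : mon_lattice poly k x ->
  exists y z, [/\ bitab_lattice poly k y, mon_lattice poly k z & x =~ (y + q ^+ N *: z)%E].
Proof.
move=> Mx; elim: N => [|N [y [z [Ly Mz xE]]]].
  exists 0%E, x; split=> //; first exact: qspan0.
  by move=> A t _; rewrite /qadd /qscale add0r scale1r.
have [y' Ly' [z' Mz' zE]] := mon_lattice_mod_q Mz.
exists (y + q ^+ N *: y')%E, z'; split=> //.
  by apply/(qspanD Ly)/qspanZ => //; apply: poly_scalar_qX.
move=> A t rt; have /eqP := zE A t rt; rewrite /qsub subr_eq /qscale => /eqP zE'.
rewrite (xE A t rt) /qadd /qscale zE' scalerDr scalerA -exprSr -addrA; congr (_ + _).
exact: addrC.
Qed.

Lemma mon_bitab_lattice k x : mon_lattice poly k x -> bitab_lattice poly k x.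
Proof.
move=> Mx; have [N NP] := mon_lattice_denominator k.
have [y [z [Ly Mz xE]]] := mon_lattice_mod_qX N Mx.
by apply: (qspan_eq _ (qspanD Ly (NP z Mz))) => A t rt; rewrite xE.
Qed.

Lemma bitab_lattice_sum k x : bitab_lattice poly k x ->
  exists s : seq (tableau n * tableau n * {poly K}),
    all (fun e => [&& is_tab e.1.1, is_tab e.1.2 & shape e.1.1 == shape e.1.2]) s /\
    x =~ (fun A t => \sum_(e <- s) polyq e.2 *: bitab t e.1.1 e.1.2).
Proof.
move: x; apply: qspan_least; first split.
- by exists [::]; split=> // A t _; rewrite big_nil.
- move=> x y [s [tab_s xE]] [s' [tab_s' yE]]; exists (s ++ s').
  by rewrite all_cat tab_s tab_s'; split=> // A t rt; rewrite big_cat /qadd xE ?yE.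
- move=> c x [p ->] [s [tab_s xE]]; exists [seq (e.1, p * e.2) | e <- s].
  rewrite all_map; split=> [|A t rt]; first exact: sub_all tab_s.
  rewrite big_map /qscale xE // scaler_sumr; apply: eq_bigr => e _ /=.
  by rewrite scalerA /polyq tofracM.
- by move=> x y xy [s [tab_s xE]]; exists s; split=> // A t rt; rewrite -xy ?xE.
move=> _ [T [T' [tT tT' sh _ ->]]]; exists [:: (T, T', 1)].
rewrite /= tT tT' sh eqxx; split=> // A t _.
by rewrite big_seq1 /= /polyq tofrac1 scale1r.
Qed.

Lemma vanish_in_qL k x : vanish_mod_q k x -> in_qL x.
Proof.
case=> y /mon_bitab_lattice/bitab_lattice_sum[s [tab_s yE]] xE; exists s; split=> // A t rt.
rewrite xE // /qscale yE // scaler_sumr; apply: eq_bigr => e _.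
by rewrite scalerA.
Qed.

End Integrality.

Theorem theorem1p1 (K : fieldType) (charK : [pchar K] =i pred0)
  (n : nat) (n_ge1 : (0 < n)%N) (w u : seq 'I_n) (size_wu : size w = size u) :
  congr_qL
    (fun A t => qmonomial t w u)
    (fun A t => if (RS w).2 == (RS u).2 then bitab (K:=K) t (RS w).1 (RS u).1 else 0).
Proof. exact: vanish_in_qL (cong_RS_bitab K size_wu). Qed.
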